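(* Let $\lambda_1\ge\cdots\ge\lambda_q$ be the eigenvalues of the averaged periodogram matrix $I_m(y_t,y_t)$ with $m$ fixed. Then for each $k=0,\dots,s$ and each $j\in N_k$, as $n\to\infty$, $$\lambda_j=O_p(n^{2d_k}).$$
   Context: Setting. Fix integers $p\ge 1$, $q\ge 2$, $1\le s\le r<q$, $a_0=q-r$, and $a_1,\dots,a_s\ge 1$ with $a_1+\cdots+a_s=r$. Put $N_0=\{1,\dots,a_0\}$ and $N_k=\{(a_0+\cdots+a_{k-1})+1,\dots,a_0+\cdots+a_k\}$ for $k\ge1$. Fix reals $-p+1/2<d_s<\cdots<d_0<1/2$. For $\omega\in[-\pi,\pi]$ let $\mathbf\Psi(\omega)$ be a complex $q\times q$ matrix with $\mathbf\Psi(-\omega)=\overline{\mathbf\Psi(\omega)}$ and entries $\Psi_{ab}(\omega)=(1-e^{-i\omega})^{-d_{ab}}\tau_{ab}(\omega)e^{i\phi_{ab}(\omega)}$, where $d_{aa}=d_k$ for $a\in N_k$, $d_{ab}\le\min(d_k,d_h)$ for $a\in N_k$, $b\in N_h$, $a\ne b$, the $\tau_{ab}$ are positive even real functions and the $\phi_{ab}$ odd real functions, all continuously differentiable in an interval containing $0$. Let $\psi_k=\frac1{2\pi}\int_{-\pi}^{\pi}e^{ik\omega}\mathbf\Psi(\omega)d\omega$, with $\psi_0=\mathbf I$, and $z_t=\sum_{k=-\infty}^{\infty}\psi_k\varepsilon_{t-k}$, where $\{\varepsilon_t\}$ are iid $q$-vectors with mean $0$, covariance $2\pi\mathbf\Sigma$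 ($\mathbf\Sigma$ symmetric positive definite) and $E\|\varepsilon_t\|^4<\infty$. The spectral density $\mathbf f(\omega)=\mathbf\Psi(\omega)\mathbf\Sigma\mathbf\Psi^*(\omega)$ of $\{z_t\}$ is assumed to be of the form $\mathbf f=\mathbf\Upsilon\mathbf f^\dagger\mathbf\Upsilon^*$ with $\mathbf\Upsilon(\omega)$ diagonal with $a$-th diagonal entry $(1-e^{-i\omega})^{-d_k}$ for $a\in N_k$, and $\mathbf f^\dagger$ Hermitian positive definite, continuous at $0$ and real at $0$. Write $z_t=\mathrm{vec}(u_t^{(0)},\dots,u_t^{(s)})$ with $u_t^{(k)}$ of dimension $a_k$. The observed $q\times1$ series is $y_t=\mathbf A z_t=\sum_{k=0}^s\mathbf A_ku_t^{(k)}$, $\mathbf A=[\mathbf A_0\ \cdots\ \mathbf A_s]$, with $\mathbf A_k$ real $q\times a_k$ and $\mathbf A$ having linearly independent columns; all rows of $\mathbf A_0$ are nonzero. Averaged periodogram. For observations $\xi_1,\dots,\xi_n$ let $J_\xi(\omega_j)=\left(2\pi\sum_{t=1}^n|h_t^{p-1}|^2\right)^{-1/2}\sum_{t=1}^nh_t^{p-1}\xi_te^{i\omega_jt}$, $\omega_j=2\pi j/n$, $h_t=\frac12(1-e^{i2\pi t/n})$ (so $p=1$ is no taper); $I_{\xi\zeta}(\omega_j)=J_\xi(\omega_j)J_\zeta^*(\omega_j)$; $I_m(\xi_t,\zeta_t)=\sum_{j=1}^m\mathrm{Re}\,I_{\xi\zeta}(\omega_j)$, where $m>q+3$ is a fixed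 integer. *)

(* Defs.v *)
(* MathComp-Analysis; complex numbers are R[i] from mathcomp-real-closed. *)
From HB Require Import structures.
From mathcomp Require Import all_boot all_order all_algebra.
From mathcomp Require Import complex.
From mathcomp Require Import all_classical all_reals all_analysis.

Set Implicit Arguments.
Unset Strict Implicit.
Unset Printing Implicit Defensive.

Import Order.TTheory GRing.Theory Num.Theory.
Import numFieldNormedType.Exports.
Import ComplexField Normc.

Local Open Scope classical_set_scope.
Local Open Scope ring_scope.
Local Open Scope complex_scope.
Local Open Scope sesquilinear_scope.

Section ComplexFunctions.
Context {R : realType}.

Definition cis (t : R) : R[i] := cos t +i* sin t.

(* Principal argument, in ]-pi, pi]; only meaningful for z != 0. *)
Definition carg (z : R[i]) : R :=
  if 0 <= complex.Im z then acos (complex.Re z / normc z)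
  else - acos (complex.Re z / normc z).

(* Principal value of z^a for z != 0. *)
Definition cpow (z : R[i]) (a : R) : R[i] :=
  (normc z `^ a)%:C * cis (a * carg z).

(* (1 - e^{-iw})^{-d}; at w = 0 it is undefined for d > 0, so it is only used
   for 0 < |w| <= pi. *)
Definition fracdiff (d w : R) : R[i] := cpow (1 - cis (- w)) (- d).

Definition cintegral (D : set R) (g : R -> R[i]) : R[i] :=
  (\int[lebesgue_measure]_(w in D) complex.Re (g w))
  +i* (\int[lebesgue_measure]_(w in D) complex.Im (g w)).

Definition square_integrable (D : set R) (g : R -> R[i]) : Prop :=
  [/\ measurable_fun D (fun w => complex.Re (g w)),
      measurable_fun D (fun w => complex.Im (g w)) &
      lebesgue_measure.-integrable D (fun w => (normc (g w) ^+ 2)%:E)].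

Definition fourier_coef q (Psi : R -> 'M[R[i]]_q) (k : int) : 'M[R[i]]_q :=
  \matrix_(a, b) (((2 * pi)^-1)%:C *
    cintegral `[- pi, pi] (fun w => cis (k%:~R * w) * Psi w a b)).

Definition C1_near0 (g : R -> R) : Prop :=
  exists2 delta : R, 0 < delta &
    forall w : R, `|w| < delta -> derivable g w 1 /\ {for w, continuous (g^`())%classic}.

Definition cmx m n (M : 'M[R]_(m, n)) : 'M[R[i]]_(m, n) :=
  map_mx (real_complex R) M.

Definition sym_posdef n (M : 'M[R]_n) : Prop :=
  M^T = M /\ forall v : 'cV[R]_n, v != 0 -> 0 < (v^T *m M *m v) 0 0.

Definition herm_posdef n (M : 'M[R[i]]_n) : Prop :=
  M ^t* = M /\ forall v : 'cV[R[i]]_n, v != 0 -> 0 < (v ^t* *m M *m v) 0 0.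

(* Eigenvalues with algebraic multiplicity, in nonincreasing order. *)
Definition ordered_eigenvalues n (M : 'M[R]_n) (lam : 'I_n -> R) : Prop :=
  char_poly M = \prod_(i < n) ('X - (lam i)%:P) /\
  forall i j : 'I_n, (i <= j)%N -> lam j <= lam i.

End ComplexFunctions.

(* N_k, with coordinates numbered from 0: the k-th of the consecutive blocks of
   sizes a 0, a 1, ... *)
Definition in_block (a : nat -> nat) (k i : nat) : bool :=
  (\sum_(l < k) a l <= i < \sum_(l < k.+1) a l)%N.

Section Probability.
Context {R : realType} {d : measure_display} {T : measurableType d}.
Variable P : probability T R.

Definition vec q (u : q.-tuple R) : 'cV[R]_q := \col_a tnth u a.

Definition independent_family q (e : int -> {RV P >-> q.-tuple R}) : Prop :=
  forall (F : seq int) (B : int -> set (q.-tuple R)),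
    uniq F -> (forall t, measurable (B t)) ->
    P (\bigcap_(t in [set` F]) (e t @^-1` B t)) =
    (\prod_(t <- F) P (e t @^-1` B t))%E.

Definition identically_distributed q (e : int -> {RV P >-> q.-tuple R}) : Prop :=
  forall (s t : int) (B : set (q.-tuple R)), measurable B ->
    distribution P (e s) B = distribution P (e t) B.

(* z_t = \sum_{k in Z} psi_k e_{t-k}, the series converging in mean square;
   the partial sum runs over k = l - N, i.e. -N <= k <= N. *)
Definition linear_process q (psi : int -> 'M[R[i]]_q)
    (e z : int -> {RV P >-> q.-tuple R}) : Prop :=
  let partial_sum (N : nat) (t : int) (x : T) : 'cV[R[i]]_q :=
    \sum_(0 <= l < (2 * N).+1)
      psi (l%:Z - N%:Z) *m cmx (vec (e (t - (l%:Z - N%:Z)) x)) in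
  let error (N : nat) (t : int) (a : 'I_q) (x : T) : R :=
    normc ((cmx (vec (z t x)) - partial_sum N t x) a 0) ^+ 2 in
  forall (t : int) (a : 'I_q), ('E_P[error N t a])%E @[N --> \oo] --> (0%R)%:E.

(* X_n = O_p(c_n).  The event {|X_n| > K c_n} is bounded through a measurable
   cover, so that no measurability of X_n is presupposed; for measurable X_n
   this says P(|X_n| > K c_n) <= eps. *)
Definition bigO_p (X : nat -> T -> R) (c : nat -> R) : Prop :=
  forall eps : R, 0 < eps -> exists K : R, \forall n \near \oo,
    exists E : set T, [/\ measurable E, (P E <= eps%:E)%E &
      [set x | K * c n < `|X n x|] `<=` E].

End Probability.

Section Periodogram.
Context {R : realType}.

Definition taper (n t : nat) : R[i] :=
  (2^-1)%:C * (1 - cis (2 * pi * t%:R / n%:R)).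

Definition fourier_freq (n j : nat) : R := 2 * pi * j%:R / n%:R.

(* Tapered discrete Fourier transform of xi_1, ..., xi_n, with taper order p. *)
Definition dft q (p n : nat) (xi : int -> 'cV[R]_q) (w : R) : 'cV[R[i]]_q :=
  ((Num.sqrt (2 * pi * \sum_(1 <= t < n.+1) normc (taper n t ^+ p.-1) ^+ 2))^-1)%:C
  *: \sum_(1 <= t < n.+1)
       (taper n t ^+ p.-1 * cis (w * t%:R)) *: cmx (xi t%:Z).

Definition cross_periodogram q1 q2 (p n : nat)
    (xi : int -> 'cV[R]_q1) (zeta : int -> 'cV[R]_q2) (w : R) : 'M[R[i]]_(q1, q2) :=
  dft p n xi w *m (dft p n zeta w) ^t*.

Definition averaged_periodogram q1 q2 (p n m : nat)
    (xi : int -> 'cV[R]_q1) (zeta : int -> 'cV[R]_q2) : 'M[R]_(q1, q2) :=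
  \sum_(1 <= j < m.+1)
    map_mx (@complex.Re R) (cross_periodogram p n xi zeta (fourier_freq n j)).

End Periodogram.

(* Main.v *)
(** By the min-max principle, for j in N_k the eigenvalue lambda_j is at most the maximum of
    the quadratic form of I_m(y, y) on unit vectors orthogonal to the columns of A_0, ...,
    A_(k-1). On these vectors only the coordinates z_b with b in N_k, ..., N_s contribute, so
    lambda_j is at most a constant times the sum over such b and over j <= m of
    |J_{z_b}(w_j)|^2, and by Markov's inequality it suffices that
    E |J_{z_b}(w_j)|^2 = O(n^(2 d_k)).

    The innovations being orthogonal in L^2, Bessel's inequality bounds this expectation by a
    constant times n^-1 times the integral of |H_n|^2 |Psi_b|^2, where H_n is the Fourier sum
    of the tapered exponential t |-> h_t^(p-1) e^(i w_j t); only an upper bound is needed, so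
    the completeness of the exponentials plays no role. Since
    |H_n(w)| <= C n (1 + n |w|)^-p and |Psi_b(w)| <= C |w|^-d_k near 0, splitting the integral
    at |w| = 1 / n gives the order n^(2 d_k): the part near 0 converges because d_k < 1/2, the
    other one because d_k > - p + 1/2. *)
Require Import Defs.
From HB Require Import structures.
From mathcomp Require Import all_boot all_order all_algebra.
From mathcomp Require Import perm complex.
From mathcomp Require Import all_classical all_reals all_analysis measurable_realfun.
From mathcomp Require Import ring lra zify.

Set Implicit Arguments.
Unset Strict Implicit.
Unset Printing Implicit Defensive.

Import Order.TTheory GRing.Theory Num.Theory.
Import numFieldNormedType.Exports.
Import ComplexField Normc.

Local Open Scope classical_set_scope.
Local Open Scope ring_scope.
Local Open Scope complex_scope.
Local Open Scope sesquilinear_scope.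

(** * Eigenvalues of a symmetric matrix *)

(** The eigenvalues never enter an expectation: the min-max bound is an inequality valid for every
    [n] and every sample point, and probability is applied only to its measurable majorant [beta].

    On the probabilistic side, [z_t] is a mean-square limit of sums over a window of innovations
    centred at [t], whereas orthogonality and Bessel's inequality call for a single window common to
    all [t]. Moving the windows to the origin leaves, for fixed [n], a fixed number of terms whose
    coefficients tend to 0; they disappear as the truncation grows, before [n] does.

    On the analytic side, the kernel decays around the frequency [- w_j] instead of 0. As [m] is
    fixed, [w_j = O(1 / n)], and the change of centre costs a constant. Away from 0 only square
    integrability of the transfer function is used: there the squared kernel alone gives
    [n^(2 - 2 p)], and [2 - 2 p < 1 + 2 d_k] is once more the condition [- p + 1 / 2 < d_k]. *)

Lemma char_poly_similar (C : comUnitRingType) n (P D : 'M[C]_n) :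
  P \in unitmx -> char_poly (invmx P *m D *m P) = char_poly D.
Proof.
move=> Pu; rewrite /char_poly.
have -> : char_poly_mx (invmx P *m D *m P) =
    map_mx polyC (invmx P) *m char_poly_mx D *m map_mx polyC P.
  rewrite /char_poly_mx mulmxBr mulmxBl !map_mxM; congr (_ - _).
  by rewrite mul_mx_scalar -scalemxAl -map_mxM mulVmx // map_mx1 scalemx1.
by rewrite !det_mulmx mulrAC -det_mulmx -map_mxM mulVmx // map_mx1 det1 mul1r.
Qed.

(** One half of the Courant-Fischer principle. If [beta < lam j], the form exceeds [beta] times the
    squared norm at every nonzero vector of the span of the eigenvectors for [lam 0, ..., lam j];
    this span has dimension [j + 1 > c], so it meets the left kernel of [B]. Test vectors are
    complex because the spectral decomposition is taken over [R[i]]. *)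
Lemma ordered_eigenvalues_le (R : realType) n c (M : 'M[R]_n) (lam : 'I_n -> R)
    (B : 'M[R]_(n, c)) (beta : R) :
  M^T = M -> ordered_eigenvalues M lam ->
  (forall v : 'rV[R[i]]_n, v *m cmx B = 0 ->
    (v *m cmx M *m v ^t*) 0 0 <= beta%:C * (v *m v ^t*) 0 0) ->
  forall j : 'I_n, (c <= j)%N -> lam j <= beta.
Proof.
move=> Msym [Mchar lam_mono] quad j cj.
have Mherm : cmx M \is hermsymmx.
  apply/is_hermitianmxP; rewrite expr0 scale1r.
  by apply/matrixP => x y; rewrite !mxE -[in LHS]Msym mxE; exact/esym/conjc_real.
have /hermitian_normalmx/orthomx_spectralP := Mherm.
set P := spectralmx _; set D := spectral_diag _ => Mdec.
have Punit : P \in unitmx by exact: spectral_unit.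
have Punitary : P \is unitarymx by exact: spectral_unitarymx.
have charC : \prod_(x <- [tuple D 0 i | i < n]) ('X - x%:P) =
   \prod_(x <- [tuple (lam i)%:C | i < n]) ('X - x%:P).
  rewrite !big_map.
  have -> : \prod_(i < n) ('X - (D 0 i)%:P) = char_poly (cmx M).
    rewrite Mdec char_poly_similar // char_poly_trig ?diag_mx_is_trig //.
    by apply: eq_bigr => i _; rewrite mxE eqxx.
  rewrite /cmx -map_char_poly Mchar rmorph_prod.
  by apply: eq_bigr => i _; rewrite /= map_polyXsubC.
(* The spectral decomposition lists the eigenvalues in its own order; unique factorisation of the
   characteristic polynomial gives the permutation [sg] that sorts them. *)
have : perm_eq [tuple D 0 i | i < n] [tuple (lam i)%:C | i < n].
  exact: (prod_XsubC_eq charC).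
rewrite perm_sym => /tuple_permP[sg lamD].
have {lamD} lamD i : D 0 (sg i) = (lam i)%:C.
  have := congr1 (fun s => nth 0 s i) lamD.
  by rewrite -!tnth_nth !tnth_mktuple.
rewrite leNgt; apply/negP => ltbeta.
(* [Sel] selects the eigenvectors for [lam 0, ..., lam j]. The matrix [K] has [j + 1] rows and only
   [c] columns, so some combination [u] of these eigenvectors is killed by [B]. *)
pose J := j.+1; have Jn : (J <= n)%N by exact: ltn_ord.
pose Sel : 'M[R[i]]_(J, n) := \matrix_(i, l) (l == sg (widen_ord Jn i))%:R.
pose K := Sel *m P *m cmx B.
have : kermx K != 0.
  rewrite kermx_eq0 -ltn_neqAle || rewrite kermx_eq0.
  by apply/negP => /eqP rK; have := rank_leq_col K; rewrite rK leqNgt ltnS cj.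
move=> /rowV0Pn[u /sub_kermxP uK u0].
pose v := u *m Sel *m P.
have /quad : v *m cmx B = 0 by rewrite -uK /K /v !mulmxA.
pose w := u *m Sel.
have wE l : w 0 (sg (widen_ord Jn l)) = u 0 l.
  rewrite mxE (bigD1 l) //= mxE eqxx mulr1 big1 ?addr0 // => i il.
  by rewrite mxE (inj_eq perm_inj) -val_eqE /= val_eqE eq_sym (negbTE il) mulr0.
have w0 (l : 'I_n) : (j < l)%N -> w 0 (sg l) = 0.
  move=> jl; rewrite mxE big1 // => i _; rewrite mxE (inj_eq perm_inj).
  by rewrite -val_eqE /= gtn_eqF ?mulr0 // (leq_trans (ltn_ord i)).
have vtE : v ^t* = invmx P *m w ^t*.
  by rewrite /v -/w trmx_mul map_mxM invmx_unitary.
have vvE : (v *m v ^t*) 0 0 = \sum_i w 0 (sg i) * (w 0 (sg i))^*%C.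
  rewrite vtE /v -/w mulmxA mulmxK // mxE (reindex_inj (@perm_inj _ sg)) /=.
  by apply: eq_bigr => i _; rewrite !mxE.
have vMvE : (v *m cmx M *m v ^t*) 0 0 =
    \sum_i (lam i)%:C * (w 0 (sg i) * (w 0 (sg i))^*%C).
  rewrite Mdec vtE /v -/w !mulmxA mulmxK // mulmxK //.
  rewrite mxE (reindex_inj (@perm_inj _ sg)) /=; apply: eq_bigr => i _.
  rewrite [in X in X * _ = _]mxE (bigD1 (sg i)) //= big1 ?addr0; last first.
    by move=> l li; rewrite [X in _ * X]mxE (negbTE li) mulr0.
  rewrite [diag_mx D _ _]mxE eqxx mulr1n lamD !mxE /=.
  by rewrite mulrAC mulrC.
rewrite vMvE vvE mulr_sumr -subr_le0 -sumrB => le0.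
(* In eigenvector coordinates the hypothesis on the form says that these nonnegative terms have a
   nonpositive sum. Hence all of them vanish, and since [lam i > beta] for [i <= j], so does [u]. *)
have pos i : true -> 0 <= (lam i)%:C * (w 0 (sg i) * (w 0 (sg i))^*%C) -
   beta%:C * (w 0 (sg i) * (w 0 (sg i))^*%C).
  move=> _; rewrite -mulrBl; case: (ltnP j i) => ji.
    by rewrite w0 // mul0r mulr0.
  rewrite mulr_ge0 ?mulcJ_ge0 // subr_ge0 lecR (le_trans (ltW ltbeta)) //.
  exact: lam_mono.
have sum0 : forall i, (lam i)%:C * (w 0 (sg i) * (w 0 (sg i))^*%C) -
   beta%:C * (w 0 (sg i) * (w 0 (sg i))^*%C) = 0.
  move=> i; apply: (psumr_eq0P pos) => //.
  by apply/le_anti; rewrite le0 sumr_ge0.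
case/rV0Pn: u0 => l /negP; apply; rewrite -wE.
have /eqP := sum0 (widen_ord Jn l).
rewrite -mulrBl mulf_eq0 subr_eq0 (inj_eq (@complexI R)) gt_eqF /=; last first.
  by rewrite (lt_le_trans ltbeta) // lam_mono //= -ltnS ltn_ord.
by rewrite mulf_eq0 conjc_eq0 orbb.
Qed.

(** A bound in probability concerns [|lam j|], which the min-max upper bound controls only once the
    sign is known. *)
Lemma ordered_eigenvalues_ge0 (R : realType) n (M : 'M[R]_n) (lam : 'I_n -> R) :
  ordered_eigenvalues M lam ->
  (forall v : 'rV[R]_n, 0 <= (v *m M *m v^T) 0 0) -> forall j, 0 <= lam j.
Proof.
move=> [Mchar _] psd j.
have : root (char_poly M) (lam j).
  by rewrite Mchar (bigD1 j) //= rootM root_XsubC eqxx.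
rewrite -eigenvalue_root_char => /eigenvalueP[v vM v0].
have := psd v; rewrite vM -scalemxAl mxE pmulr_lge0 //.
have vv_ge0 i : true -> 0 <= v 0 i * v^T i 0 by rewrite mxE -expr2 sqr_ge0.
rewrite mxE lt0r sumr_ge0 ?andbT //.
apply: contraNneq v0 => /psumr_eq0P sum0; apply/eqP/rowP => i; rewrite mxE.
have /eqP := sum0 vv_ge0 i isT.
by rewrite mxE -expr2 sqrf_eq0 => /eqP.
Qed.

(** * The taper and its Fourier sum *)

Section ComplexModulus.
Context {R : realType}.
Implicit Types (x y z : R[i]) (t : R).

Lemma normc_ge0 z : 0 <= normc z.
Proof. by case: z => a b; rewrite /normc sqrtr_ge0. Qed.

Lemma sqr_normcE z : normc z ^+ 2 = complex.Re z ^+ 2 + complex.Im z ^+ 2.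
Proof. by case: z => a b; rewrite /normc sqr_sqrtr // addr_ge0 ?sqr_ge0. Qed.

Lemma normcX z n : normc (z ^+ n) = normc z ^+ n.
Proof.
by elim: n => [|n IH]; rewrite ?expr0 ?normc1 // !exprS normcM IH.
Qed.

Lemma le_normc_sum (I : Type) (r : seq I) (F : I -> R[i]) :
  normc (\sum_(i <- r) F i) <= \sum_(i <- r) normc (F i).
Proof.
elim/big_ind2 : _ => // [|x x' y y' hx hy]; first by rewrite normc0.
by rewrite (le_trans (le_normcD _ _)) // lerD.
Qed.

Lemma normc_real t : normc t%:C = `|t|.
Proof. by rewrite /= expr0n addr0 sqrtr_sqr. Qed.

Lemma cisD t u : cis (t + u) = cis t * cis u.
Proof.
rewrite /cis sinD cosD; apply/eqP; rewrite eq_complex /=.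
by rewrite addrC [cos t * sin u + _]addrC !eqxx.
Qed.

Lemma cis0 : cis (0 : R) = 1.
Proof. by rewrite /cis sin0 cos0. Qed.

Lemma normc_cis t : normc (cis t) = 1.
Proof. by rewrite /= cos2Dsin2 sqrtr1. Qed.

Lemma cisX t n : cis t ^+ n = cis (t * n%:R).
Proof.
elim: n => [|n IH]; first by rewrite mulr0 cis0.
by rewrite exprS IH -cisD -natr1 mulrDr mulr1 addrC.
Qed.

Lemma cis2pi : cis (2 * pi : R) = 1.
Proof. by rewrite /cis mulr2n mulrDl mul1r -mulr2n cos2pi sin2pi. Qed.

Lemma normc_1Bcis t : normc (1 - cis t) = 2 * `|sin (t / 2)|.
Proof.
apply/eqP; rewrite -(@eqrXn2 _ 2) ?normc_ge0 ?mulr_ge0 // sqr_normcE exprMn.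
rewrite /= real_normK ?num_real // add0r sqrrN.
set u := t / 2; have tE : t = u *+ 2 by rewrite -mulr_natr divfK.
rewrite tE {tE}.
rewrite cos_mulr2n sin_mulr2n; have := cos2Dsin2 u.
move: (cos u) (sin u) => c s cs; have h : c ^+ 2 = 1 - s ^+ 2 by rewrite -cs addrK.
apply/eqP; transitivity ((2 - 2 * c ^+ 2) ^+ 2 + 4 * c ^+ 2 * s ^+ 2); first by ring.
by rewrite h; ring.
Qed.

Lemma sin_le t : 0 <= t -> sin t <= t.
Proof.
move=> t0; have [|c _] := @MVT_segment R (@sin R) (@cos R) 0 t t0 (fun u _ => is_derive_sin u).
  by apply: continuous_subspaceT; exact: continuous_sin.
by rewrite sin0 !subr0 => ->; rewrite ler_piMl // cos_le1.
Qed.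

Lemma abs_sin_le t : `|sin t| <= `|t|.
Proof.
have key (u : R) : 0 <= u -> `|sin u| <= u.
  move=> u0; rewrite ler_norml; apply/andP; split; last exact: sin_le.
  case: (lerP u 1) => u1; last by rewrite (le_trans _ (sin_geN1 u)) // lerN2 ltW.
  rewrite (@le_trans _ _ 0) ?oppr_le0 // sin_ge0_pi // u0 /=.
  by rewrite (le_trans u1) // (le_trans _ (pi_ge2 R)) // ler1n.
case: (leP 0 t) => t0; first by rewrite (ger0_norm t0) key.
by rewrite (ltr0_norm t0) -normrN -sinN key // oppr_ge0 ltW.
Qed.

(** A weak Jordan inequality. With [u = t / 2], duplication and the mean value theorem give
    [sin t = 2 u cos c cos u] for some [c] in [[0, u]], and both cosines are at least
    [cos (pi / 4)], whose square is [1 / 2]. *)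
Lemma sin_ge_half t : 0 <= t <= pi / 2 -> t / 2 <= sin t.
Proof.
move=> /andP[t0 tpi]; set u := t / 2.
have u0 : 0 <= u by rewrite divr_ge0.
have -> : t = u *+ 2 by rewrite -mulr_natr divfK.
have [|c] := @MVT_segment R (@sin R) (@cos R) 0 u u0 (fun u _ => is_derive_sin u).
  by apply: continuous_subspaceT; exact: continuous_sin.
rewrite in_itv /= sin0 !subr0 => /andP[c0 cu] su.
have ci : cos (pi / 4) ^+ 2 = 2^-1 :> R.
  have := cos_mulr2n (pi / 4 : R).
  have -> : (pi / 4) *+ 2 = pi / 2 :> R by rewrite -mulr_natr; field.
  rewrite cos_pihalf => /esym/eqP; rewrite subr_eq0 -mulr_natr => /eqP h.
  by apply: (@mulIf _ 2) => //; rewrite h mulVf.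
have pp := pi_gt0 R.
have k0 : 0 <= cos (pi / 4 : R).
  by apply: cos_ge0_pihalf; apply/andP; split; lra.
have upi : u <= pi / 4 by rewrite /u; lra.
have mono (v : R) : 0 <= v -> v <= pi / 4 -> cos (pi / 4) <= cos v.
  rewrite le_eqVlt => /orP[/eqP <- _|v0]; first by rewrite cos0 cos_le1.
  rewrite le_eqVlt => /orP[/eqP -> //|vpi].
  by rewrite ltW // ltr_cos // in_itv /=; apply/andP; split; lra.
rewrite sin_mulr2n su.
have h1 := mono u u0 upi; have h2 := mono c c0 (le_trans cu upi).
have : cos (pi / 4) ^+ 2 <= cos u * cos c by rewrite expr2 ler_pM.
rewrite ci => h; rewrite mulrA -mulr_natr.
have := ler_wpM2r u0 h; lra.
Qed.

Lemma normc_1Bcis_le t : normc (1 - cis t) <= `|t|.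
Proof.
rewrite normc_1Bcis -ler_pdivlMl // (le_trans (abs_sin_le _)) //.
by rewrite normrM mulrC [ `|2^-1|]ger0_norm.
Qed.

Lemma normc_1Bcis_ge t : `|t| <= pi -> `|t| / 2 <= normc (1 - cis t).
Proof.
move=> tpi; rewrite normc_1Bcis.
have -> : `|sin (t / 2)| = `|sin (`|t| / 2)|.
  case: (leP 0 t) => t0; first by rewrite (ger0_norm t0).
  by rewrite (ltr0_norm t0) mulNr sinN normrN.
set u := `|t| / 2; have u0 : 0 <= u by rewrite divr_ge0.
have := @sin_ge_half u; rewrite u0 /= ler_pM2r // => /(_ tpi).
have := ler_norm (sin u); rewrite /u; lra.
Qed.

End ComplexModulus.

Section TaperKernel.

(* With [x = e^{i w}] and [zeta = e^{2 i pi / n}], this is, up to the factor [2 ^ P], the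
   Fourier sum of the taper of order [P + 1]; for [P = 0] it is the Dirichlet kernel. *)
Definition taper_kernel (C : nzRingType) (P n : nat) (zeta x : C) : C :=
  \sum_(1 <= t < n.+1) (1 - zeta ^+ t) ^+ P * x ^+ t.

(* Multiplying by [x] shifts [t], and
   [1 - zeta^(t-1) = (1 - zeta^-1) + zeta^-1 * (1 - zeta^t)]. *)
Lemma taper_kernel_shift (C : fieldType) (P n : nat) (zeta x : C) :
  (0 < P)%N -> zeta != 0 -> zeta ^+ n = 1 ->
  x * taper_kernel P n zeta x =
  \sum_(l < P.+1) ((1 - zeta^-1) ^+ (P - l) * zeta^-1 ^+ l * taper_kernel l n zeta x) *+ 'C(P, l).
Proof.
move=> P0 z0 zn.
transitivity (\sum_(1 <= t < n.+1) (1 - zeta ^+ t / zeta) ^+ P * x ^+ t); last first.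
  transitivity (\sum_(1 <= t < n.+1) \sum_(l < P.+1)
      ((1 - zeta^-1) ^+ (P - l) * zeta^-1 ^+ l * ((1 - zeta ^+ t) ^+ l * x ^+ t)) *+ 'C(P, l)).
    apply: eq_bigr => t _.
    have -> : 1 - zeta ^+ t / zeta = (1 - zeta^-1) + zeta^-1 * (1 - zeta ^+ t) by ring.
    rewrite exprDn mulr_suml; apply: eq_bigr => l _.
    by rewrite mulrnAl exprMn !mulrA.
  by rewrite exchange_big; apply: eq_bigr => l _; rewrite sumrMnl /taper_kernel mulr_sumr.
rewrite /taper_kernel mulr_sumr; case: n zn => [|n] zn; first by rewrite !big_geq.
(* The two sums match up to a shift of the index, except for the last term on the left and the first
   on the right. Both are zero: [zeta ^+ t = 1] in the former, [zeta / zeta = 1] in the latter, and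
   [0 < P]. *)
rewrite big_nat_recr //= zn subrr expr0n gtn_eqF // mul0r mulr0 addr0.
rewrite [RHS]big_nat_recl //= expr1 divff // subrr expr0n gtn_eqF // mul0r add0r.
apply: eq_bigr => t _.
by rewrite [zeta ^+ t.+1]exprSr mulfK // mulrCA -exprS.
Qed.

Context {R : realType}.

Lemma taper_kernel_bound (P n : nat) (zeta x : R[i]) :
  normc zeta = 1 -> normc x = 1 -> normc (taper_kernel P n zeta x) <= 2 ^+ P * n%:R.
Proof.
move=> z1 x1; rewrite (le_trans (le_normc_sum _ _)) //.
rewrite mulr_natr -[X in _ <= _ *+ X](subn1 n.+1) -sumr_const_nat.
apply: ler_sum => t _; rewrite normcM !normcX x1 expr1n mulr1.
rewrite lerXn2r ?nnegrE ?normc_ge0 // (le_trans (le_normcD _ _)) //.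
by rewrite normcN normcX z1 expr1n normc1.
Qed.

Lemma normc_1BX (y : R[i]) P : normc y = 1 -> normc (1 - y ^+ P) <= P%:R * normc (1 - y).
Proof.
move=> y1; elim: P => [|P IH]; first by rewrite expr0 subrr normc0 mul0r.
have -> : 1 - y ^+ P.+1 = (1 - y) + y * (1 - y ^+ P) by rewrite exprS; ring.
rewrite (le_trans (le_normcD _ _)) // normcM y1 mul1r -natr1 mulrDl mul1r addrC.
by rewrite lerD2r.
Qed.

(* The constant [8] is an upper bound for [2 * pi]. *)
Lemma taper_kernel_decay (P : nat) : exists2 C : R, 0 <= C &
  forall (l n : nat) (zeta x : R[i]), (l <= P)%N -> (0 < n)%N ->
    normc zeta = 1 -> normc x = 1 -> zeta ^+ n = 1 -> normc (1 - zeta) <= 8 / n%:R ->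
    (1 + n%:R * normc (1 - x)) ^+ l.+1 * normc (taper_kernel l n zeta x) <= C * n%:R.
Proof.
elim: P => [|P [C C0 IH]].
  (* For the Dirichlet kernel the geometric sum gives [|(1 - x) D| <= 2]; with the trivial bound
     [|D| <= n] this makes [n + 2 n]. *)
  exists 3 => // l n zeta x; rewrite leqn0 => /eqP -> n0 z1 x1 zn zle.
  rewrite expr1 mulrDl mul1r -mulrA -normcM.
  have -> : (1 - x) * taper_kernel 0 n zeta x = x - x ^+ n.+1.
    rewrite mulr_sumr; transitivity (\sum_(1 <= t < n.+1) (x ^+ t - x ^+ t.+1)).
      by apply: eq_bigr => t _; rewrite expr0 mul1r mulrBl mul1r -exprS.
    rewrite (@telescope_sumr_eq _ _ _ (fun t => - x ^+ t)) // => [|i _].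
      by rewrite opprK addrC expr1.
    by rewrite opprK addrC.
  have := taper_kernel_bound 0 n z1 x1; rewrite expr0 mul1r => k1.
  have := le_normcD x (- x ^+ n.+1); rewrite normcN normcX x1 expr1n => k2.
  have := @ler_wpM2l _ n%:R (ler0n _ _) _ _ k2; lra.
pose Q := P.+1.
(* Here [24 = 3 * 8], where [3 n] bounds [1 + n |1 - x|] and [8 / n] bounds [|1 - zeta^-1|]. The two
   summands of [C'] below serve the cases of large and bounded [w]. *)
pose K : R := \sum_(l < Q) (24 ^+ (Q - l)) *+ 'C(Q, l).
have K0 : 0 <= K by apply: sumr_ge0 => l _; rewrite mulrn_wge0 // exprn_ge0.
pose C' := 2 * (K * C) + (2 + 16 * Q%:R) ^+ Q.+1 * 2 ^+ Q.
have C'0 : 0 <= C'.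
  by rewrite /C' addr_ge0 // ?mulr_ge0 ?exprn_ge0 ?addr_ge0 ?mulr_ge0 // ler0n.
exists (C + C') => [|l n zeta x]; first by rewrite addr_ge0.
rewrite leq_eqVlt => /orP[/eqP -> {l}|lP] n0 z1 x1 zn zle; last first.
  rewrite (le_trans (IH l n zeta x lP n0 z1 x1 zn zle)) // ler_wpM2r //.
  by rewrite lerDl.
rewrite (@le_trans _ _ (C' * n%:R)) //; last by rewrite ler_wpM2r // lerDr.
set y := n%:R * normc (1 - x); set N := normc _; set w := 1 + y.
have nR : 0 < n%:R :> R by rewrite ltr0n.
have y0 : 0 <= y by rewrite mulr_ge0 ?normc_ge0 // ltW.
have w0 : 0 <= w by rewrite addr_ge0.
have N0 : 0 <= N by exact: normc_ge0.
have Nle : N <= 2 ^+ Q * n%:R by exact: taper_kernel_bound.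
have zn0 : zeta != 0.
  by apply/eqP => z0; move: z1; rewrite z0 normc0 => /eqP; rewrite eq_sym oner_eq0.
have zV1 : normc zeta^-1 = 1 by rewrite normcV z1 invr1.
have zVle : normc (1 - zeta^-1) <= 8 / n%:R.
  have -> : 1 - zeta^-1 = - zeta^-1 * (1 - zeta) by field.
  by rewrite normcM normcN zV1 mul1r.
(* For bounded [w] the trivial bound suffices; otherwise the term of index [Q] in the
   shift identity is absorbed in the left-hand side. *)
case: (leP w (2 + 16 * Q%:R)) => wQ.
  rewrite (@le_trans _ _ ((2 + 16 * Q%:R) ^+ Q.+1 * (2 ^+ Q * n%:R))) //.
    by rewrite ler_pM ?exprn_ge0 // lerXn2r // nnegrE (le_trans w0).
  rewrite mulrA ler_wpM2r ?ler0n // lerDr mulr_ge0 // mulr_ge0 //.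
pose S := \sum_(l < Q) ((8 / n%:R) ^+ (Q - l) * normc (taper_kernel l n zeta x)) *+ 'C(Q, l).
(* The shift identity is solved for [(1 - x) T_Q], with [T_l] the kernel of index [l]. Its top term
   leaves the factor [1 - zeta^-Q], of modulus at most [8 Q / n]; the lower orders are left to the
   induction hypothesis. *)
have wN : w * N <= (1 + 8 * Q%:R) * N + n%:R * S.
  rewrite mulrDl mulrDl -addrA lerD2l /y -mulrA -normcM.
  have -> : (1 - x) * taper_kernel Q n zeta x = (1 - zeta^-1 ^+ Q) * taper_kernel Q n zeta x -
      \sum_(l < Q) ((1 - zeta^-1) ^+ (Q - l) * zeta^-1 ^+ l * taper_kernel l n zeta x) *+ 'C(Q, l).
    rewrite mulrBl mul1r (taper_kernel_shift _ (ltn0Sn P) zn0 zn) big_ord_recr /=.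
    by rewrite binn mulr1n subnn expr0 mul1r; ring.
  rewrite (@le_trans _ _ (n%:R * (Q%:R * (8 / n%:R) * N + S))) //; last first.
    by rewrite mulrDr lerD2r le_eqVlt; apply/orP; left; apply/eqP; field; rewrite gt_eqF.
  rewrite ler_wpM2l // (le_trans (le_normcD _ _)) // lerD //.
    rewrite normcM ler_wpM2r // (le_trans (normc_1BX _ zV1)) //.
    by rewrite ler_wpM2l.
  rewrite normcN (le_trans (le_normc_sum _ _)) // ler_sum // => l _.
  rewrite normcMn lerMn2r; apply/orP; right.
  rewrite !normcM !normcX zV1 expr1n mulr1 ler_wpM2r ?normc_ge0 //.
  by rewrite lerXn2r // nnegrE ?normc_ge0 // divr_ge0.
(* The threshold [2 + 16 Q] is twice [1 + 8 Q], so the first term of [wN] is at most half of its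
   left-hand side. *)
have w2 : w * N <= 2 * (n%:R * S).
  have : (2 + 16 * Q%:R) * N <= w * N by rewrite ler_wpM2r // ltW.
  lra.
rewrite exprSr -mulrA (@le_trans _ _ (w ^+ Q * (2 * (n%:R * S)))) //.
  by rewrite ler_wpM2l // exprn_ge0.
suff wS : w ^+ Q * (n%:R * S) <= K * C * n%:R.
  rewrite mulrCA (@le_trans _ _ (2 * (K * C * n%:R))) //; first by rewrite ler_wpM2l.
  by rewrite mulrA ler_wpM2r // ?ler0n // lerDl mulr_ge0 // exprn_ge0 // addr_ge0 // mulr_ge0.
rewrite /S /K mulr_sumr mulr_sumr -mulrA mulr_suml ler_sum // => -[l /= lQ] _.
suff step : w ^+ Q * (n%:R * ((8 / n%:R) ^+ (Q - l) * normc (taper_kernel l n zeta x))) <=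
    24 ^+ (Q - l) * (C * n%:R).
  have := ler_wpM2r (ler0n R 'C(Q, l)) step.
  apply: etrans; apply/esym; congr (_ <= _); first by rewrite mulr_natr !mulrnAr.
  by rewrite mulr_natr -mulrnAl.
have wn : w <= 3 * n%:R.
  have : normc (1 - x) <= 2.
    by rewrite (le_trans (le_normcD _ _)) // normcN x1 normc1.
  move=> /(@ler_wpM2l _ n%:R (ltW nR)); rewrite -/y.
  have : 1 <= n%:R :> R by rewrite ler1n.
  rewrite /w; lra.
(* Of the [Q] factors [w], [l + 1] are spent on the induction hypothesis for order [l]. The other
   [Q - l - 1] are at most [3 n] each and, together with the extra factor [n], are compensated by
   [(8 / n) ^+ (Q - l)]. *)
have -> : w ^+ Q = w ^+ (Q - l.+1) * w ^+ l.+1 by rewrite -exprD subnK.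
rewrite (@le_trans _ _ ((3 * n%:R) ^+ (Q - l.+1) * (C * n%:R) *
   (n%:R * (8 / n%:R) ^+ (Q - l)))) //.
  rewrite [leLHS](_ : _ = w ^+ (Q - l.+1) *
     (w ^+ l.+1 * normc (taper_kernel l n zeta x)) * (n%:R * (8 / n%:R) ^+ (Q - l))); last by ring.
  rewrite ler_wpM2r ?mulr_ge0 ?exprn_ge0 ?divr_ge0 ?ler0n //.
  rewrite ler_pM ?exprn_ge0 ?mulr_ge0 ?normc_ge0 ?exprn_ge0 //.
    by rewrite lerXn2r // nnegrE mulr_ge0.
  exact: IH.
rewrite subSS subSn // exprMn exprMn exprVn.
rewrite [leLHS](_ : _ = 3 ^+ (P - l) * 8 ^+ (P - l).+1 * (C * n%:R)); last first.
  by rewrite !exprS; field; rewrite expf_neq0 gt_eqF.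
rewrite ler_wpM2r ?mulr_ge0 //.
have -> : 24 = 3 * 8 :> R by ring.
by rewrite exprMn ler_wpM2r ?exprn_ge0 // exprS ler_peMl ?exprn_ge0 // ler1n.
Qed.

End TaperKernel.

Section TaperNorm.
Context {R : realType}.

(* Bernoulli's inequality, in the form of the tangent to [x ^ P] at [1 / 2]. *)
Lemma tangent_half (x : R) P : 0 <= x -> (2 * x) ^+ P >= 1 + P%:R * (2 * x - 1).
Proof.
move=> x0; elim: P => [|P IH]; first by rewrite expr0 mul0r addr0.
have x2 : 0 <= 2 * x by rewrite mulr_ge0.
rewrite exprS (le_trans _ (ler_wpM2l x2 IH)) // -natr1.
rewrite -subr_ge0 (_ : _ - _ = P%:R * (2 * x - 1) ^+ 2); last by ring.
by rewrite mulr_ge0 // sqr_ge0.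
Qed.

Lemma sqr_normc_taper n t :
  normc (taper n t) ^+ 2 = (1 - cos (2 * pi * t%:R / n%:R)) / 2 :> R.
Proof.
rewrite sqr_normcE /taper; set x : R := _ / _ .
have := cos2Dsin2 x; rewrite /= => h.
transitivity (4^-1 * (1 - 2 * cos x + (cos x ^+ 2 + sin x ^+ 2))); first by field.
by rewrite h; field.
Qed.

Lemma sum_roots_unity n : (1 < n)%N ->
  \sum_(1 <= t < n.+1) cis (2 * pi * t%:R / n%:R) = 0 :> R[i].
Proof.
move=> n1; have n0 : (n%:R : R) != 0 by rewrite pnatr_eq0 gtn_eqF // (ltn_trans _ n1).
pose z : R[i] := cis (2 * pi / n%:R).
have zE t : cis (2 * pi * t%:R / n%:R) = z ^+ t :> R[i] by rewrite cisX mulrAC.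
have zn : z ^+ n = 1 by rewrite cisX divfK // cis2pi.
have z1 : 1 - z != 0.
  apply/eqP => h; have : normc (1 - z) = 0 by rewrite h normc0.
  rewrite normc_1Bcis => /eqP; rewrite mulf_eq0 normr_eq0 pnatr_eq0 /= gt_eqF //.
  have pp := pi_gt0 R; have nR : (2 : R) <= n%:R by rewrite ler_nat.
  apply: sin_gt0_pi; rewrite divr_gt0 ?divr_gt0 ?mulr_gt0 ?ltr0n ?(ltn_trans _ n1) //=.
  rewrite [ltLHS](_ : _ = pi / n%:R); last by field.
  rewrite ltr_pdivrMr ?ltr0n ?(ltn_trans _ n1) //.
  by rewrite ltr_pMr // ltr1n.
apply: (mulfI z1); rewrite mulr0.
under eq_bigr do rewrite zE.
rewrite mulr_sumr; under eq_bigr => t _ do rewrite mulrBl mul1r -exprS -opprB.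
by rewrite sumrN telescope_sumr // exprS zn mulr1 expr1 subrr oppr0.
Qed.

(** Bernoulli's inequality is applied to each [|h_t|^2]; since [2 |h_t|^2 - 1 = - cos (2 pi t / n)],
    the linear terms add up to the real part of a sum of roots of unity, which is zero. This makes
    the squared normalisation of the transform of order [1 / n]. For [n = 1] the taper itself is
    zero. *)
Lemma sum_taper_ge P n : (1 < n)%N ->
  n%:R / 2 ^+ P <= \sum_(1 <= t < n.+1) normc (taper n t ^+ P) ^+ 2 :> R.
Proof.
move=> n1; rewrite ler_pdivrMr ?exprn_gt0 // mulr_suml.
pose x t : R := normc (taper n t) ^+ 2.
have tan t : 1 + P%:R * (2 * x t - 1) <= normc (taper n t ^+ P) ^+ 2 * 2 ^+ P.
  rewrite normcX -exprM mulnC exprM -exprMn [X in X ^+ P]mulrC.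
  by rewrite tangent_half // sqr_ge0.
apply: le_trans (ler_sum _ (fun t _ => tan t)).
rewrite big_split /= -mulr_sumr sumr_const_nat subn1 /=.
suff -> : \sum_(1 <= t < n.+1) (2 * x t - 1) = 0 :> R by rewrite mulr0 addr0.
have /(congr1 (@complex.Re R)) := sum_roots_unity n1.
rewrite raddf_sum /= => h; rewrite -[RHS]oppr0 -[in RHS]h -sumrN.
by apply: eq_bigr => t _; rewrite /x sqr_normc_taper; field.
Qed.

End TaperNorm.

(** * Fourier coefficients and Bessel's inequality *)

Section ComplexParts.
Context {R : realType}.

Lemma Re_mul (x y : R[i]) :
  complex.Re (x * y) = complex.Re x * complex.Re y - complex.Im x * complex.Im y.
Proof. by case: x; case: y. Qed.

Lemma Im_mul (x y : R[i]) :
  complex.Im (x * y) = complex.Re x * complex.Im y + complex.Im x * complex.Re y.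
Proof. by case: x => a b; case: y => c e /=; rewrite [b * c]mulrC. Qed.

Lemma Re_add (x y : R[i]) : complex.Re (x + y) = complex.Re x + complex.Re y.
Proof. by case: x; case: y. Qed.

Lemma Im_add (x y : R[i]) : complex.Im (x + y) = complex.Im x + complex.Im y.
Proof. by case: x; case: y. Qed.

Lemma Re_sum (I : Type) (r : seq I) (F : I -> R[i]) :
  complex.Re (\sum_(i <- r) F i) = \sum_(i <- r) complex.Re (F i).
Proof. by elim/big_rec2 : _ => [//|i x y _ <-]; rewrite Re_add. Qed.

Lemma Im_sum (I : Type) (r : seq I) (F : I -> R[i]) :
  complex.Im (\sum_(i <- r) F i) = \sum_(i <- r) complex.Im (F i).
Proof. by elim/big_rec2 : _ => [//|i x y _ <-]; rewrite Im_add. Qed.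

End ComplexParts.

Section ComplexMeasurable.
Context {R : realType} {d : measure_display} {T : measurableType d}.
Implicit Types (D : set T) (f g : T -> R[i]).

Definition cmeasurable D g :=
  measurable_fun D (fun w => complex.Re (g w)) /\
  measurable_fun D (fun w => complex.Im (g w)).

Lemma cmeasurableM D f g : cmeasurable D f -> cmeasurable D g ->
  cmeasurable D (fun w => f w * g w).
Proof.
move=> [f1 f2] [g1 g2]; split.
  under eq_fun do rewrite Re_mul.
  by apply: measurable_funB; apply: measurable_funM.
under eq_fun do rewrite Im_mul.
by apply: measurable_funD; apply: measurable_funM.
Qed.

Lemma cmeasurable_cst D (c : R[i]) : cmeasurable D (fun=> c).
Proof. by split; exact: measurable_cst. Qed.

Lemma cmeasurable_sum D (I : Type) (r : seq I) (f : I -> T -> R[i]) :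
  (forall i, cmeasurable D (f i)) -> cmeasurable D (fun w => \sum_(i <- r) f i w).
Proof.
move=> mf; elim: r => [|i r [IH1 IH2]].
  by under eq_fun do rewrite big_nil; exact: cmeasurable_cst.
under eq_fun do rewrite big_cons.
by split; [under eq_fun do rewrite Re_add|under eq_fun do rewrite Im_add];
  apply: measurable_funD => //; case: (mf i).
Qed.

Lemma cmeasurable_sqr_normc D g : cmeasurable D g ->
  measurable_fun D (fun w => normc (g w) ^+ 2).
Proof.
move=> [g1 g2]; under eq_fun do rewrite sqr_normcE !expr2.
by apply: measurable_funD; apply: measurable_funM.
Qed.

Lemma cmeasurableD D f g : cmeasurable D f -> cmeasurable D g ->
  cmeasurable D (fun w => f w + g w).
Proof.
move=> [f1 f2] [g1 g2]; split.
  by under eq_fun do rewrite Re_add; apply: measurable_funD.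
by under eq_fun do rewrite Im_add; apply: measurable_funD.
Qed.

Lemma cmeasurable_real D (h : T -> R) : measurable_fun D h ->
  cmeasurable D (fun w => (h w)%:C).
Proof. by move=> mh; split => //=; exact: measurable_cst. Qed.

End ComplexMeasurable.

Section ComplexIntegral.
Context {R : realType}.
Implicit Types (D : set R) (f g h : R -> R[i]).
Local Notation mu := (@lebesgue_measure R).

Definition cintegrable D g :=
  mu.-integrable D (fun w => (complex.Re (g w))%:E) /\
  mu.-integrable D (fun w => (complex.Im (g w))%:E).

Lemma cmeasurable_cis D (k : R) : cmeasurable D (fun w => cis (k * w)).
Proof.
by split; apply: measurable_funTS; apply: continuous_measurable_fun => w /=;
  apply: continuous_comp; [exact: mulrl_continuous|
    (exact: continuous_cos || exact: continuous_sin)|exact: mulrl_continuous|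
    (exact: continuous_cos || exact: continuous_sin)].
Qed.

Lemma integrableZl_EFin D (k : R) (h : R -> R) : measurable D ->
  mu.-integrable D (EFin \o h) -> mu.-integrable D (EFin \o (fun w => k * h w)).
Proof.
move=> mD hi; rewrite (_ : EFin \o _ = (fun w => k%:E * (h w)%:E)%E) //.
exact: integrableZl.
Qed.

Lemma integrableD_EFin D (h1 h2 : R -> R) : measurable D ->
  mu.-integrable D (EFin \o h1) -> mu.-integrable D (EFin \o h2) ->
  mu.-integrable D (EFin \o (fun w => h1 w + h2 w)).
Proof.
move=> mD i1 i2; rewrite (_ : EFin \o _ = (fun w => (h1 w)%:E + (h2 w)%:E)%E) //.
exact: integrableD.
Qed.

Lemma integrableB_EFin D (h1 h2 : R -> R) : measurable D ->
  mu.-integrable D (EFin \o h1) -> mu.-integrable D (EFin \o h2) ->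
  mu.-integrable D (EFin \o (fun w => h1 w - h2 w)).
Proof.
move=> mD i1 i2; rewrite (_ : EFin \o _ = (fun w => (h1 w)%:E - (h2 w)%:E)%E) //.
exact: integrableB.
Qed.

Lemma cintegrableZ D (c : R[i]) g : measurable D ->
  cintegrable D g -> cintegrable D (fun w => c * g w).
Proof.
move=> mD [g1 g2]; split.
  under eq_fun do rewrite Re_mul.
  by apply: integrableB_EFin => //; exact: integrableZl_EFin.
under eq_fun do rewrite Im_mul.
by apply: integrableD_EFin => //; exact: integrableZl_EFin.
Qed.

Lemma cintegrableD D f g : measurable D ->
  cintegrable D f -> cintegrable D g -> cintegrable D (fun w => f w + g w).
Proof.
move=> mD [f1 f2] [g1 g2]; split.
  by under eq_fun do rewrite Re_add EFinD; exact: integrableD.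
by under eq_fun do rewrite Im_add EFinD; exact: integrableD.
Qed.

Lemma cintegralZ D (c : R[i]) g : measurable D -> cintegrable D g ->
  cintegral D (fun w => c * g w) = c * cintegral D g.
Proof.
move=> mD [g1 g2]; apply/eqP; rewrite eq_complex /= Re_mul Im_mul /=.
under eq_Rintegral do rewrite Re_mul.
rewrite RintegralB //; [|exact: (integrableZl_EFin _ mD g1)|exact: (integrableZl_EFin _ mD g2)].
rewrite !RintegralZl // eqxx /=.
under eq_Rintegral do rewrite Im_mul.
rewrite RintegralD //; [|exact: (integrableZl_EFin _ mD g2)|exact: (integrableZl_EFin _ mD g1)].
by rewrite !RintegralZl.
Qed.

Lemma cintegralD D f g : measurable D -> cintegrable D f -> cintegrable D g ->
  cintegral D (fun w => f w + g w) = cintegral D f + cintegral D g.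
Proof.
move=> mD [f1 f2] [g1 g2]; apply/eqP; rewrite eq_complex /=.
under eq_Rintegral do rewrite Re_add.
rewrite RintegralD // eqxx /=.
under eq_Rintegral do rewrite Im_add.
by rewrite RintegralD.
Qed.

Lemma cintegrable0 D : cintegrable D (fun=> 0).
Proof. by split; exact: integrable0. Qed.

Lemma cintegrable_sum D (I : Type) (r : seq I) (f : I -> R -> R[i]) : measurable D ->
  (forall i, cintegrable D (f i)) -> cintegrable D (fun w => \sum_(i <- r) f i w).
Proof.
move=> mD fi; elim: r => [|i r IH].
  by under eq_fun do rewrite big_nil; exact: cintegrable0.
by under eq_fun do rewrite big_cons; exact: cintegrableD.
Qed.

Lemma cintegral_sum D (I : Type) (r : seq I) (f : I -> R -> R[i]) : measurable D ->
  (forall i, cintegrable D (f i)) ->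
  cintegral D (fun w => \sum_(i <- r) f i w) = \sum_(i <- r) cintegral D (f i).
Proof.
move=> mD fi; elim: r => [|i r IH].
  under [X in cintegral _ X]eq_fun do rewrite big_nil.
  rewrite big_nil; apply/eqP; rewrite eq_complex /=.
  by rewrite !Rintegral_cst // !mul0r eqxx.
under [X in cintegral _ X]eq_fun do rewrite big_cons.
by rewrite big_cons cintegralD // ?IH //; exact: cintegrable_sum.
Qed.

Lemma integrable_cst_EFin D (k : R) : measurable D -> (mu D < +oo)%E ->
  mu.-integrable D (EFin \o (fun=> k)).
Proof.
move=> mD fD; apply: measurable_bounded_integrable => //.
exact: bounded_cst.
Qed.

Lemma square_integrable_cintegrable D g : measurable D -> (mu D < +oo)%E ->
  square_integrable D g -> cintegrable D g.
Proof.
move=> mD fD [g1 g2 gi].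
have dom : mu.-integrable D (EFin \o (fun w => 1 + normc (g w) ^+ 2)).
  by apply: integrableD_EFin => //; exact: integrable_cst_EFin.
have sq (x y : R) : `|x| <= 1 + (x ^+ 2 + y ^+ 2).
  have h : 0 <= (2 * `|x| - 1) ^+ 2 by exact: sqr_ge0.
  have := sqr_ge0 y; have := real_normK (num_real x); move: h; nra.
split; apply: le_integrable dom => //; try exact/measurable_EFinP.
  move=> w _; rewrite lee_fin [leRHS]ger0_norm ?addr_ge0 ?sqr_ge0 // sqr_normcE.
  exact: sq.
move=> w _; rewrite lee_fin [leRHS]ger0_norm ?addr_ge0 ?sqr_ge0 // sqr_normcE.
by rewrite [X in _ + X]addrC; exact: sq.
Qed.

Lemma square_integrableM D h g (M : R) : measurable D ->
  cmeasurable D h -> (forall w, D w -> normc (h w) <= M) ->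
  square_integrable D g -> square_integrable D (fun w => h w * g w).
Proof.
move=> mD mh hM [g1 g2 gi].
have [m1 m2] := cmeasurableM mh (conj g1 g2); split => //.
have dom := integrableZl_EFin (M ^+ 2) mD gi.
apply: le_integrable dom => //.
  apply/measurable_EFinP; exact: (cmeasurable_sqr_normc (conj m1 m2)).
move=> w Dw; have nn (x : R) : 0 <= x ^+ 2 by exact: sqr_ge0.
rewrite lee_fin (ger0_norm (nn _)) (ger0_norm (mulr_ge0 (nn _) (nn _))).
rewrite normcM exprMn ler_wpM2r ?nn // lerXn2r ?nnegrE ?normc_ge0 ?hM //.
by rewrite (le_trans (normc_ge0 (h w))) ?hM.
Qed.

Lemma square_integrable_bounded D h (M : R) : measurable D -> (mu D < +oo)%E ->
  cmeasurable D h -> (forall w, D w -> normc (h w) <= M) -> square_integrable D h.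
Proof.
move=> mD fD mh hM; rewrite (_ : h = (fun w => h w * 1)); last first.
  by apply/funext => w; rewrite mulr1.
apply: (square_integrableM mD mh hM); split; [exact: measurable_cst..|].
exact: integrable_cst_EFin.
Qed.

End ComplexIntegral.

Section Bessel.
Context {R : realType}.
Implicit Types (g h : R -> R[i]).
Local Notation mu := (@lebesgue_measure R).
Local Notation D := (`[- pi, pi]%classic : set R).

(** Sign and normalisation are those of an entry of [fourier_coef]; the associated orthonormal
    exponentials are therefore [cis (- (k w))]. *)
Definition fourier g (k : int) : R[i] :=
  ((2 * pi)^-1)%:C * cintegral D (fun w => cis (k%:~R * w) * g w).

Lemma pi_itv_lty : (mu D < +oo)%E.
Proof. by rewrite lebesgue_measure_itv /=; case: ifP => _; rewrite ltry. Qed.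

Let mD : measurable D. Proof. exact: measurable_itv. Qed.
Let fD := pi_itv_lty.

Lemma sin_natpi n : sin (pi * n%:R) = 0 :> R.
Proof.
elim: n => [|n IH]; first by rewrite mulr0 sin0.
by rewrite -natr1 mulrDr mulr1 sinDpi IH oppr0.
Qed.

Lemma sin_intpi (k : int) : sin (k%:~R * pi) = 0 :> R.
Proof.
case: k => n; first by rewrite mulrC sin_natpi.
by rewrite NegzE mulrNz mulNr sinN mulrC sin_natpi oppr0.
Qed.

Lemma cintegral_cis (k : int) : k != 0 -> cintegral D (fun w => cis (k%:~R * w)) = 0.
Proof.
move=> k0; have kR : (k%:~R : R) != 0 by rewrite intr_eq0.
have lt : - pi < pi :> R by rewrite (lt_trans _ (pi_gt0 R)) // oppr_lt0 pi_gt0.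
have cont (F : R -> R) : continuous F -> continuous (fun w : R => F (k%:~R * w)).
  move=> cF w; apply: continuous_comp; [exact: mulrl_continuous|exact: cF].
have FTC (f F : R -> R) : continuous f ->
    (forall x : R, is_derive x 1 F (f x)) -> F pi = F (- pi) ->
    \int[mu]_(w in D) f w = 0.
  move=> cf dF Fpi; rewrite /Rintegral (@continuous_FTC2 _ f F) //.
  - by rewrite Fpi subee.
  - exact: continuous_subspaceT.
  - have cF : continuous F.
      by move=> x; apply/differentiable_continuous/derivable1_diffP; apply: ex_derive.
    split=> [x _||]; first exact: ex_derive.
    + exact/cvg_at_right_filter/cF.
    + exact/cvg_at_left_filter/cF.
  - by move=> x _; rewrite derive1E derive_val.
apply/eqP; rewrite eq_complex /=; apply/andP; split; apply/eqP.
  apply: (FTC _ (fun w : R => sin (k%:~R * w) / k%:~R)) => [|x|].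
  - exact/cont/continuous_cos.
  - apply: is_derive_eq; rewrite /GRing.scale /=; field.
    exact: kR.
  - by rewrite mulrN sinN sin_intpi oppr0.
apply: (FTC _ (fun w : R => - cos (k%:~R * w) / k%:~R)) => [|x|].
- exact/cont/continuous_sin.
- apply: is_derive_eq; rewrite /GRing.scale /=; field.
  exact: kR.
- by rewrite mulrN cosN.
Qed.

Lemma fourier_cis (u v : int) : fourier (fun w => cis (- (v%:~R * w))) u = (u == v)%:R.
Proof.
rewrite /fourier; under [X in cintegral _ X]eq_fun do
  rewrite -cisD -mulrBl -intrB.
case: eqVneq => [->|uv]; last by rewrite cintegral_cis ?mulr0 // subr_eq0.
under [X in cintegral _ X]eq_fun do rewrite subrr mul0r cis0.
have -> : cintegral D (fun=> 1) = (2 * pi : R)%:C.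
  apply/eqP; rewrite eq_complex /= !Rintegral_cst // mul0r mul1r eqxx andbT.
  rewrite [X in fine X]lebesgue_measure_itv /= lte_fin.
  rewrite (lt_trans _ (pi_gt0 R)) ?oppr_lt0 ?pi_gt0 //=.
  by rewrite opprK -mulr2n mulr_natl.
by rewrite -rmorphM mulVf ?rmorph1 // mulf_neq0 // gt_eqF // pi_gt0.
Qed.

Lemma cintegrable_cisM g (k : R) :
  square_integrable D g -> cintegrable D (fun w => cis (k * w) * g w).
Proof.
move=> gi; apply: square_integrable_cintegrable => //.
apply: (@square_integrableM _ _ _ _ 1) => //; first exact: cmeasurable_cis.
by move=> w _; rewrite normc_cis.
Qed.

Lemma fourier_sum (I : Type) (r : seq I) (c : I -> R[i]) (f : I -> R -> R[i]) k :
  (forall i, square_integrable D (f i)) ->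
  fourier (fun w => \sum_(i <- r) c i * f i w) k = \sum_(i <- r) c i * fourier (f i) k.
Proof.
move=> fi; rewrite /fourier.
under [X in cintegral _ X]eq_fun do rewrite mulr_sumr.
rewrite cintegral_sum //; last first.
  move=> i /=; under [X in cintegrable _ X]eq_fun do rewrite mulrCA.
  exact/cintegrableZ/cintegrable_cisM.
rewrite mulr_sumr; apply: eq_bigr => i _.
under [X in cintegral _ X]eq_fun do rewrite mulrCA.
rewrite cintegralZ //; last exact: cintegrable_cisM.
by rewrite [LHS]mulrCA.
Qed.

Lemma conj_cis (t : R) : (cis t)^*%C = cis (- t).
Proof. by rewrite /cis sinN cosN. Qed.

Lemma conjcM (x y : R[i]) : (x * y)^*%C = x^*%C * y^*%C.
Proof. exact: rmorphM. Qed.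

Lemma conjc_sum (I : Type) (r : seq I) (F : I -> R[i]) :
  (\sum_(i <- r) F i)^*%C = \sum_(i <- r) (F i)^*%C.
Proof.
elim/big_rec2 : _ => [|i x y _ <-]; first exact: conjc0.
exact: (rmorphD (@conjc R)).
Qed.

Lemma bessel g (F : seq int) : square_integrable D g -> uniq F ->
  \sum_(u <- F) normc (fourier g u) ^+ 2 <=
  (2 * pi)^-1 * \int[mu]_(w in D) (normc (g w) ^+ 2).
Proof.
move=> gi uF; set a := fourier g.
pose S w := \sum_(u <- F) a u * cis (- (u%:~R * w)).
have cisi u : square_integrable D (fun w => cis (- (u%:~R * w))).
  apply: (@square_integrable_bounded _ _ _ 1) => //.
    by under [X in cmeasurable _ X]eq_fun do rewrite -mulNr; exact: cmeasurable_cis.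
  by move=> w _; rewrite normc_cis.
have Si : square_integrable D S.
  apply: (@square_integrable_bounded _ _ _ (\sum_(u <- F) normc (a u))) => //.
    apply: cmeasurable_sum => u; apply: cmeasurableM; first exact: cmeasurable_cst.
    by under [X in cmeasurable _ X]eq_fun do rewrite -mulNr; exact: cmeasurable_cis.
  move=> w _; rewrite (le_trans (le_normc_sum _ _)) // ler_sum // => u _.
  by rewrite normcM normc_cis mulr1.
have aS u : u \in F -> fourier S u = a u.
  move=> uF'; rewrite fourier_sum // (bigD1_seq u) //= fourier_cis eqxx mulr1.
  rewrite big1 ?addr0 // => v vu; rewrite fourier_cis eq_sym (negbTE vu) mulr0 //.
(* The inner product with the partial sum [S] is computed for a general [f] and used for [g] and for
   [S]. These have the same coefficients over [F], so the cross term and the squared norm of [S]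
   coincide when [|g - S|^2] is expanded. *)
have conjS f : square_integrable D f ->
    cintegrable D (fun w => f w * (S w)^*%C) /\
    cintegral D (fun w => f w * (S w)^*%C) =
    (2 * pi)%:C * \sum_(u <- F) (a u)^*%C * fourier f u.
  move=> fi; rewrite (_ : (fun w => f w * _) =
      fun w => \sum_(u <- F) (a u)^*%C * (cis (u%:~R * w) * f w)); last first.
    apply/funext => w; rewrite /S conjc_sum mulr_sumr; apply: eq_bigr => u _.
    by rewrite conjcM conj_cis opprK; ring.
  split.
    apply: cintegrable_sum => // u; apply: cintegrableZ => //; exact: cintegrable_cisM.
  rewrite cintegral_sum //; last first.
    by move=> u; apply: cintegrableZ => //; exact: cintegrable_cisM.
  rewrite mulr_sumr; apply: eq_bigr => u _; rewrite cintegralZ //; last exact: cintegrable_cisM.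
  rewrite /fourier [in RHS]mulrCA; congr (_ * _); rewrite mulrA -rmorphM divff ?mul1r //.
  by rewrite mulf_neq0 // gt_eqF // pi_gt0.
have [[gS _] gSE] := conjS g gi.
have [[SS _] SSE] := conjS S Si.
pose A := \sum_(u <- F) normc (a u) ^+ 2.
have sqrE (z : R[i]) : complex.Re (z^*%C * z) = normc z ^+ 2.
  by rewrite sqr_normcE; case: z => x y /=; ring.
have reA : complex.Re ((2 * pi)%:C * \sum_(u <- F) (a u)^*%C * a u) = 2 * pi * A.
  rewrite Re_mul mul0r subr0 Re_sum; congr (_ * _).
  by apply: eq_bigr => u _; exact: sqrE.
have E1 : \int[mu]_(w in D) complex.Re (g w * (S w)^*%C) = 2 * pi * A.
  by rewrite -reA -gSE.
have E2 : \int[mu]_(w in D) complex.Re (S w * (S w)^*%C) = 2 * pi * A.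
  rewrite -reA [LHS](_ : _ = complex.Re (cintegral D (fun w => S w * (S w)^*%C))) // SSE.
  by congr (complex.Re (_ * _)); apply: eq_big_seq => u uF'; rewrite aS.
have : 0 <= \int[mu]_(w in D) (normc (g w - S w) ^+ 2).
  by apply: Rintegral_ge0 => w _; exact: sqr_ge0.
have sqrB w : normc (g w - S w) ^+ 2 = normc (g w) ^+ 2 -
    2 * complex.Re (g w * (S w)^*%C) + complex.Re (S w * (S w)^*%C).
  by rewrite !sqr_normcE; case: (g w) => x y; case: (S w) => x' y' /=; ring.
under eq_Rintegral do rewrite sqrB.
have [_ _ gi3] := gi.
rewrite RintegralD //; last first.
  by apply: integrableB_EFin => //; exact: integrableZl_EFin.
rewrite RintegralB //; last exact: integrableZl_EFin.
rewrite RintegralZl // E1 E2 => h.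
rewrite ler_pdivlMl ?mulr_gt0 ?pi_gt0 // -/A.
move: h; lra.
Qed.

End Bessel.

(** * Second moments of linear processes *)

Section Independence.
Context {R : realType} {d : measure_display} {T : measurableType d}.
Variable P : probability T R.
Local Open Scope ereal_scope.

(** By uniqueness of product measures the joint law is the product of the marginal laws, and in
    Fubini's iterated integral the inner one is [x] times the mean of [Y]. *)
Lemma integral_indep_mul0 (X Y : {mfun T >-> R}) :
  (forall A B : set R, measurable A -> measurable B ->
    P (X @^-1` A `&` Y @^-1` B) = P (X @^-1` A) * P (Y @^-1` B)) ->
  P.-integrable setT (EFin \o Y) ->
  P.-integrable setT (fun x => (X x * Y x)%:E) ->
  \int[P]_x (Y x)%:E = 0 -> \int[P]_x (X x * Y x)%:E = 0.
Proof.
move=> indep Yi XYi EY.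
have mW : measurable_fun setT (fun x => (X x, Y x)) by exact: measurable_fun_pair.
pose W : {mfun T >-> (R * R)%type} := mfun_Sub (mem_set mW).
pose mX : {measure set R -> \bar R} := distribution P X.
pose mY : {measure set R -> \bar R} := distribution P Y.
pose f (z : R * R) := (z.1 * z.2)%:E.
have mf : measurable_fun setT f.
  by apply/measurable_EFinP; apply: measurable_funM.
have fWE : f \o W = (fun x => (X x * Y x)%:E) by apply/funext.
have prodE A : measurable A ->
    (distribution P X \x distribution P Y) A = distribution P W A.
  by move=> mA; apply: product_measure_unique => // B C mB mC; exact: indep.
have intf : (distribution P X \x distribution P Y).-integrable setT f.
  apply/integrableP; split => //.
  rewrite (eq_measure_integral (distribution P W)); last by move=> A mA _; exact: prodE.
  rewrite ge0_integral_distribution //; last exact: measurableT_comp.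
  by have /integrableP[_] := XYi.
transitivity (\int[distribution P W]_z f z).
  by rewrite integral_distribution ?fWE.
transitivity (\int[distribution P X \x distribution P Y]_z f z).
  by apply/esym/eq_measure_integral => A mA _; exact: prodE.
rewrite -integral12_prod_meas1 //.
apply: integral0_eq => x _ /=.
have Yi' : (distribution P Y).-integrable setT EFin.
  by apply: integrable_pushforward => //; exact: Yi.
transitivity (\int[distribution P Y]_y (x%:E * y%:E)); first exact: eq_integral.
rewrite integralZl // integral_distribution //.
by rewrite [X in _ * X]EY mule0.
Qed.

End Independence.

Lemma sqr_sum_le (R : realFieldType) (I : Type) (r : seq I) (x : I -> R) :
  (\sum_(i <- r) x i) ^+ 2 <= (size r)%:R * \sum_(i <- r) x i ^+ 2.
Proof.
elim: r => [|i r IH]; first by rewrite !big_nil expr0n mul0r.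
rewrite !big_cons /= -natr1; move: IH.
set S := \sum_(_ <- _) _; set Q := \sum_(_ <- _) _; set n : R := (size r)%:R => IH.
have Q0 : 0 <= Q by apply: sumr_ge0 => *; exact: sqr_ge0.
have [n0|n0] := eqVneq n 0.
  move: IH; rewrite n0 mul0r => IH.
  have -> : S = 0 by apply/eqP; rewrite -sqrf_eq0 eq_le IH sqr_ge0.
  by rewrite addr0 add0r mul1r lerDl.
have np : 0 < n by rewrite lt0r n0 ler0n.
have gen (m y S' Q' : R) : 0 < m -> S' ^+ 2 <= m * Q' ->
    (y + S') ^+ 2 <= (m + 1) * (y ^+ 2 + Q').
  move=> m0 h; rewrite -subr_ge0 -(pmulr_rge0 _ m0).
  rewrite [leRHS](_ : _ = (m * y - S') ^+ 2 + (m + 1) * (m * Q' - S' ^+ 2)); last by ring.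
  by rewrite addr_ge0 ?sqr_ge0 // mulr_ge0 ?subr_ge0 // addr_ge0 // ltW.
exact: gen.
Qed.

Lemma sqr_normc_sum_le (R : realType) (I : Type) (r : seq I) (x : I -> R[i]) :
  normc (\sum_(i <- r) x i) ^+ 2 <= (size r)%:R * \sum_(i <- r) normc (x i) ^+ 2.
Proof.
rewrite (le_trans _ (sqr_sum_le r (fun i => normc (x i)))) //.
rewrite lerXn2r ?nnegrE ?normc_ge0 ?le_normc_sum //.
by apply: sumr_ge0 => i _; exact: normc_ge0.
Qed.

Section WhiteNoise.
Context {R : realType} {d : measure_display} {T : measurableType d}.
Variable P : probability T R.

Lemma integral_le_sum (I : Type) (r : seq I) (k : I -> R) (f : I -> T -> R) (Y : T -> R) :
  (forall i, 0 <= k i) -> (forall i x, 0 <= f i x) ->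
  (forall i, measurable_fun setT (f i)) -> measurable_fun setT Y ->
  (forall x, 0 <= Y x) -> (forall x, Y x <= \sum_(i <- r) k i * f i x) ->
  (\int[P]_x (Y x)%:E <= \sum_(i <- r) (k i)%:E * \int[P]_x (f i x)%:E)%E.
Proof.
move=> k0 f0 mf mY Y0 Yle.
rewrite (eq_bigr (fun i => \int[P]_x ((k i)%:E * (f i x)%:E))%E); last first.
  move=> i _; rewrite ge0_integralZl_EFin // => [x _|]; first by rewrite lee_fin.
  exact/measurable_EFinP.
have mkf i : measurable_fun setT (fun x => (k i)%:E * (f i x)%:E)%E.
  by apply/measurable_EFinP; apply: measurable_funM.
rewrite -ge0_integral_sum //; last by move=> i x _; rewrite -EFinM lee_fin mulr_ge0.
apply: ge0_le_integral => //.
- by move=> x _; rewrite lee_fin.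
- exact/measurable_EFinP.
- exact: emeasurable_sum.
- move=> x _; under eq_bigr do rewrite -EFinM.
  by rewrite sumEFin lee_fin.
Qed.

Variables (e : int -> T -> R) (s : R).
Hypothesis me : forall u, measurable_fun setT (e u).
Hypothesis ie : forall u v, P.-integrable setT (fun x => (e u x * e v x)%:E).
Hypothesis e2 : forall u, (\int[P]_x (e u x * e u x)%:E)%E = s%:E.
Hypothesis eo : forall u v, u != v -> (\int[P]_x (e u x * e v x)%:E)%E = 0%E.

Lemma white_noise_real (I : eqType) (r : seq I) (a : I -> R) (u : I -> int) :
  uniq r -> injective u ->
  (\int[P]_x ((\sum_(i <- r) a i * e (u i) x) ^+ 2)%:E =
    (s * \sum_(i <- r) a i ^+ 2)%:E)%E.
Proof.
move=> ur uI.
have E x : ((\sum_(i <- r) a i * e (u i) x) ^+ 2)%:E =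
    (\sum_(i <- r) \sum_(j <- r) (a i * a j)%:E * (e (u i) x * e (u j) x)%:E)%E.
  rewrite expr2 mulr_suml -sumEFin; apply: eq_bigr => i _.
  rewrite mulr_sumr -sumEFin; apply: eq_bigr => j _.
  by rewrite -EFinM; congr EFin; ring.
under eq_integral do rewrite E.
have int2 i j : P.-integrable setT (fun x => (a i * a j)%:E * (e (u i) x * e (u j) x)%:E)%E.
  by apply: integrableZl => //; exact: ie.
rewrite integral_sum //; last by move=> i; apply: integrable_sum => // j _; exact: int2.
under eq_bigr => i _ do rewrite integral_sum //.
rewrite mulr_sumr -sumEFin; apply: eq_big_seq => i ir.
rewrite (bigD1_seq i) //= big1 ?adde0 => [|j ji].
  by rewrite integralZl ?ie // e2 -EFinM mulrC expr2.
by rewrite integralZl ?ie // eo ?mule0 // (inj_eq uI) eq_sym.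
Qed.

Lemma white_noise (I : eqType) (r : seq I) (a : I -> R[i]) (u : I -> int) :
  uniq r -> injective u ->
  (\int[P]_x (normc (\sum_(i <- r) a i * (e (u i) x)%:C) ^+ 2)%:E =
    (s * \sum_(i <- r) normc (a i) ^+ 2)%:E)%E.
Proof.
move=> ur uI.
have E x : (normc (\sum_(i <- r) a i * (e (u i) x)%:C) ^+ 2)%:E =
   (((\sum_(i <- r) complex.Re (a i) * e (u i) x) ^+ 2)%:E +
   ((\sum_(i <- r) complex.Im (a i) * e (u i) x) ^+ 2)%:E)%E.
  rewrite sqr_normcE Re_sum Im_sum -EFinD; congr (_ ^+ 2 + _ ^+ 2)%:E.
    by apply: eq_bigr => i _; rewrite Re_mul /= mulr0 subr0.
  by apply: eq_bigr => i _; rewrite Im_mul /= mulr0 add0r.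
under eq_integral do rewrite E.
have msum (b : I -> R) :
    measurable_fun setT (fun x => ((\sum_(i <- r) b i * e (u i) x) ^+ 2)%:E).
  apply/measurable_EFinP/measurable_funX; apply: measurable_sum => i.
  exact: measurable_funM.
rewrite ge0_integralD //; last 2 first.
- by move=> x _; rewrite lee_fin sqr_ge0.
- by move=> x _; rewrite lee_fin sqr_ge0.
rewrite !white_noise_real // -EFinD -mulrDr -big_split /=.
by congr (_ * _)%:E; apply: eq_bigr => i _; rewrite sqr_normcE.
Qed.

End WhiteNoise.

Lemma size_index_enum (I : finType) : size (index_enum I) = #|I|.
Proof. by rewrite -sum1_size -sum1_card; exact: eq_bigl. Qed.

Section SecondMoment.
Context {R : realType} {d : measure_display} {T : measurableType d}.
Variable P : probability T R.
Implicit Types X Y : T -> R[i].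

Definition second_moment X : \bar R := (\int[P]_x (normc (X x) ^+ 2)%:E)%E.

Lemma second_momentZ (c : R[i]) X (b : R) : cmeasurable setT X ->
  (second_moment X <= b%:E -> second_moment (fun x => c * X x)%R <= (normc c ^+ 2 * b)%:E)%E.
Proof.
move=> mX Xb; rewrite /second_moment.
under eq_integral do rewrite normcM exprMn EFinM.
rewrite ge0_integralZl_EFin ?sqr_ge0 //; last 2 first.
- by move=> x _; rewrite lee_fin sqr_ge0.
- exact/measurable_EFinP/cmeasurable_sqr_normc.
by rewrite [leRHS]EFinM; apply: lee_wpmul2l => //; rewrite lee_fin sqr_ge0.
Qed.

(** Cauchy-Schwarz in place of orthogonality: it joins the coordinates of the innovations, which may
    be correlated at equal times, and the cost is a constant factor. *)
Lemma second_moment_sum (I : Type) (r : seq I) (X : I -> T -> R[i]) (b : I -> R) :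
  (forall i, cmeasurable setT (X i)) ->
  (forall i, second_moment (X i) <= (b i)%:E)%E ->
  (second_moment (fun x => \sum_(i <- r) X i x)%R <=
    ((size r)%:R * \sum_(i <- r) b i)%:E)%E.
Proof.
move=> mX Xb.
apply: (@le_trans _ _ (\sum_(i <- r) ((size r)%:R)%:E * second_moment (X i))%E).
  apply: integral_le_sum => //.
  - by move=> i x; exact: sqr_ge0.
  - by move=> i; exact: cmeasurable_sqr_normc.
  - exact/cmeasurable_sqr_normc/cmeasurable_sum.
  - by move=> x; exact: sqr_ge0.
  - by move=> x; rewrite -mulr_sumr; exact: sqr_normc_sum_le.
rewrite mulr_sumr -sumEFin; apply: lee_sum => i _.
by rewrite [leRHS]EFinM; apply: lee_wpmul2l.
Qed.

Lemma second_momentD X Y (a b : R) : cmeasurable setT X -> cmeasurable setT Y ->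
  (second_moment X <= a%:E -> second_moment Y <= b%:E ->
   second_moment (fun x => X x + Y x)%R <= (2 * (a + b))%:E)%E.
Proof.
move=> mX mY Xa Yb.
pose Z (i : bool) := if i then X else Y; pose c (i : bool) := if i then a else b.
have := @second_moment_sum _ [:: true; false] Z c.
rewrite !big_cons big_nil /= addr0.
rewrite (_ : (fun x => \sum_(i <- _) _) = (fun x => X x + Y x)); last first.
  by apply/funext => x; rewrite !big_cons big_nil addr0.
by apply; case.
Qed.

End SecondMoment.

(** Splitting the sum over [[0, t + M)] after [t] and after [M] shows that the windows [[t, t + M)]
    and [[0, M)] differ by [t] terms at each end, however large [M] is. *)
Lemma window_shift (V : zmodType) (g : nat -> V) (t M : nat) :
  \sum_(0 <= l < M) g (t + l)%N =
  \sum_(0 <= l < M) g l + (\sum_(0 <= l < t) g (M + l)%N - \sum_(0 <= l < t) g l).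
Proof.
have shift (a b : nat) : \sum_(0 <= l < b) g (a + l)%N = \sum_(a <= l < a + b) g l.
  rewrite -{2}[a]add0n big_addn addKn; apply: eq_bigr => l _.
  by rewrite addnC.
have h1 := @big_cat_nat _ 0 +%R t 0 (t + M) predT g (leq0n _) (leq_addr _ _).
have h2 := @big_cat_nat _ 0 +%R M 0 (M + t) predT g (leq0n _) (leq_addr _ _).
by rewrite !shift addrA -h2 [(M + t)%N]addnC h1 addrC addKr.
Qed.

Section LinearProcessMoment.
Context {R : realType} {d : measure_display} {T : measurableType d}.
Variable P : probability T R.
Variables (q : nat) (e : 'I_q -> int -> T -> R) (sg : 'I_q -> R) (s : R).
Hypothesis me : forall i u, measurable_fun setT (e i u).
Hypothesis ie : forall i u v, P.-integrable setT (fun x => (e i u x * e i v x)%:E).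
Hypothesis e2 : forall i u, (\int[P]_x (e i u x * e i u x)%:E)%E = (sg i)%:E.
Hypothesis eo : forall i u v, u != v -> (\int[P]_x (e i u x * e i v x)%:E)%E = 0%E.
Hypothesis sgs : forall i, sg i <= s.
Hypothesis s0 : 0 <= s.
Variables (psi : 'I_q -> int -> R[i]).
Hypothesis psi0 : forall i (eta : R), 0 < eta ->
  exists K : nat, forall k : int, (K <= `|k|)%N -> normc (psi i k) ^+ 2 <= eta.

(* [lag] is the truncated series at time [t], whose innovations range over a window centred
   at [t]; [lead] uses the window centred at [0], common to all [t]. They differ by the terms
   [edge], whose coefficients have indices tending to infinity with [N]. *)
Let lag (N : nat) (t : int) (x : T) : R[i] := \sum_(i < q)
  \sum_(0 <= l < (2 * N).+1) psi i (l%:Z - N%:Z) * (e i (t - (l%:Z - N%:Z)) x)%:C.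
Let lead (N : nat) (t : int) (x : T) : R[i] := \sum_(i < q)
  \sum_(0 <= l < (2 * N).+1) psi i (t - (l%:Z - N%:Z)) * (e i (l%:Z - N%:Z) x)%:C.
Let edge (N t : nat) (x : T) : R[i] := \sum_(i < q)
  (\sum_(0 <= l < t) psi i (t%:Z - N%:Z - 1 - l%:Z) * (e i (N%:Z + 1 + l%:Z) x)%:C +
   - 1 * \sum_(0 <= l < t) psi i (t%:Z - l%:Z + N%:Z) * (e i (l%:Z - N%:Z) x)%:C).

Lemma lag_lead N (t : nat) x : lag N t x = lead N t x + edge N t x.
Proof.
rewrite /lag /lead /edge -big_split; apply: eq_bigr => i _ /=.
(* [g v] is the term carrying the innovation of time [v - N]. Read backwards, [lag] sums [g] over a
   window moved by [t]. *)
pose g (v : nat) := psi i (t%:Z - v%:Z + N%:Z) * (e i (v%:Z - N%:Z) x)%:C.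
have := window_shift g t (2 * N).+1.
rewrite (_ : \sum_(0 <= l < (2 * N).+1) g (t + l)%N = \sum_(0 <= l < (2 * N).+1)
    psi i (l%:Z - N%:Z) * (e i (t%:Z - (l%:Z - N%:Z)) x)%:C); last first.
  rewrite [RHS]big_nat_rev; apply: eq_big_nat => l /andP[_ lN]; rewrite /g.
  by congr (psi i _ * (e i _ x)%:C); lia.
move=> ->; rewrite mulN1r; congr (_ + (_ - _)).
  by apply: eq_big_nat => l /andP[_ lN]; rewrite /g; congr (psi i _ * (e i _ x)%:C); lia.
by apply: eq_big_nat => l /andP[_ lN]; rewrite /g; congr (psi i _ * (e i _ x)%:C); lia.
Qed.

Lemma cmeasurable_noise (I : Type) (r : seq I) (a : I -> R[i]) (u : I -> int) i :
  cmeasurable setT (fun x => \sum_(l <- r) a l * (e i (u l) x)%:C).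
Proof.
apply: cmeasurable_sum => l; apply: cmeasurableM; first exact: cmeasurable_cst.
exact: cmeasurable_real.
Qed.

Lemma second_moment_noise (I : eqType) (r : seq I) (a : I -> R[i]) (u : I -> int) i :
  uniq r -> injective u ->
  (second_moment P (fun x => \sum_(l <- r) a l * (e i (u l) x)%:C)%R <=
    (s * \sum_(l <- r) normc (a l) ^+ 2)%:E)%E.
Proof.
move=> ur uI; rewrite /second_moment (white_noise (@me i) (@ie i) (@e2 i) (@eo i)) //.
by rewrite lee_fin ler_wpM2r // sumr_ge0 // => *; exact: sqr_ge0.
Qed.

Lemma second_moment_edge (t : nat) (eta : R) : 0 < eta ->
  exists K : nat, forall N, (K <= N)%N ->
    cmeasurable setT (edge N t) /\
    (second_moment P (edge N t) <= (q%:R * (q%:R * (4 * (s * t%:R))) * eta)%:E)%E.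
Proof.
move=> eta0.
have [K HK] : exists K : nat, forall i (k : int), (K <= `|k|)%N -> normc (psi i k) ^+ 2 <= eta.
  have [K HK] := choice (fun i => psi0 i eta0).
  exists (\max_i K i) => i k Kk; apply: HK; apply: leq_trans Kk.
  exact: leq_bigmax.
(* The indices of the edge coefficients are at least [N - t] in absolute value, and their number
   does not grow with [N]. *)
exists (K + t)%N => N KN.
have mA i := @cmeasurable_noise _ (index_iota 0 t)
  (fun l => psi i (t%:Z - N%:Z - 1 - l%:Z)) (fun l => N%:Z + 1 + l%:Z) i.
have mB i := @cmeasurable_noise _ (index_iota 0 t)
  (fun l => psi i (t%:Z - l%:Z + N%:Z)) (fun l => l%:Z - N%:Z) i.
have mB' i := cmeasurableM (cmeasurable_cst setT (- 1)) (mB i).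
split; first by apply: cmeasurable_sum => i; exact: cmeasurableD.
have tE (a : nat -> R[i]) : (forall l, (l < t)%N -> normc (a l) ^+ 2 <= eta) ->
    s * \sum_(0 <= l < t) normc (a l) ^+ 2 <= s * t%:R * eta.
  move=> ale; rewrite -mulrA ler_wpM2l // mulr_natl -[X in _ <= _ *+ X]subn0.
  by rewrite -sumr_const_nat; apply: ler_sum_nat => l /andP[_ /ale].
have bound i : (second_moment P (fun x =>
   (\sum_(0 <= l < t) psi i (t%:Z - N%:Z - 1 - l%:Z) * (e i (N%:Z + 1 + l%:Z) x)%:C +
   - 1 * \sum_(0 <= l < t) psi i (t%:Z - l%:Z + N%:Z) * (e i (l%:Z - N%:Z) x)%:C)%R) <=
   (4 * (s * t%:R) * eta)%:E)%E.
  rewrite [X in X%:E](_ : _ = 2 * (s * t%:R * eta + normc (- 1 : R[i]) ^+ 2 * (s * t%:R * eta)));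
    last by rewrite normcN normc1; ring.
  apply: second_momentD => //.
    apply: le_trans (second_moment_noise _ _ (iota_uniq _ _) _) _.
      by move=> l l'; lia.
    by rewrite lee_fin tE // => l lt; apply: HK; lia.
  apply: second_momentZ => //.
  apply: le_trans (second_moment_noise _ _ (iota_uniq _ _) _) _.
    by move=> l l'; lia.
  by rewrite lee_fin tE // => l lt; apply: HK; lia.
have := second_moment_sum (index_enum 'I_q) (fun i => cmeasurableD (mA i) (mB' i)) bound.
rewrite sumr_const card_ord -mulr_natl size_index_enum card_ord.
by rewrite [X in (_ <= X%:E)%E -> _](_ : _ = q%:R * (q%:R * (4 * (s * t%:R))) * eta); last by ring.
Qed.

Variable z : nat -> T -> R.
Hypothesis mz : forall t, measurable_fun setT (z t).
Hypothesis hz : forall (t : nat) (eta : R), 0 < eta -> exists N0 : nat,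
  forall N, (N0 <= N)%N ->
    (second_moment P (fun x => ((z t x)%:C - lag N t x)%R) <= eta%:E)%E.

(** The times are fixed while [N] tends to infinity, so truncation errors and edge terms become
    negligible. What remains, grouped by innovation, has coefficients whose squares are bounded by
    [B] uniformly in [N]. The factor 2 separates this main part from the remainder, and [q] joins
    the coordinates. *)
Lemma second_moment_linear (I : finType) (tm : I -> nat) (c : I -> R[i]) (B : R) :
  (forall N : nat, \sum_(i < q) \sum_(0 <= l < (2 * N).+1)
     normc (\sum_t c t * psi i ((tm t)%:Z - (l%:Z - N%:Z))) ^+ 2 <= B) ->
  (second_moment P (fun x => \sum_t c t * (z (tm t) x)%:C)%R <= (2 * (q%:R * (s * B)))%:E)%E.
Proof.
move=> HB; apply/lee_addgt0Pr => del del0.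
pose C t : R := 2 * (1 + q%:R * (q%:R * (4 * (s * (tm t)%:R)))).
have C0 t : 0 <= C t by rewrite mulr_ge0 // addr_ge0 // !mulr_ge0.
pose M := 2 * (#|I|%:R * \sum_t normc (c t) ^+ 2 * C t).
have M0 : 0 <= M.
  by rewrite !mulr_ge0 // sumr_ge0 // => t _; rewrite mulr_ge0 // sqr_ge0.
(* The remainder will be at most [M * eta]; the denominator [M + 1] is positive even if [M = 0]. *)
pose eta := del / (M + 1).
have eta0 : 0 < eta by rewrite divr_gt0 // ltr_wpDl.
have [N1 H1] := choice (fun t => hz (tm t) eta0).
have [N2 H2] := choice (fun t => second_moment_edge (tm t) eta0).
pose N := (\max_t N1 t + \max_t N2 t)%N.
have N1N t : (N1 t <= N)%N by rewrite (leq_trans (leq_bigmax t)) // leq_addr.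
have N2N t : (N2 t <= N)%N by rewrite (leq_trans (leq_bigmax t)) // leq_addl.
have mlag t : cmeasurable setT (lag N t).
  by apply: cmeasurable_sum => i; exact: cmeasurable_noise.
have mrest t : cmeasurable setT (fun x => (z (tm t) x)%:C - lag N (tm t) x).
  rewrite (_ : (fun _ => _) = (fun x => (z (tm t) x)%:C + - 1 * lag N (tm t) x)); last first.
    by apply/funext => x; rewrite mulN1r.
  apply: cmeasurableD; first exact: cmeasurable_real.
  by apply: cmeasurableM => //; exact: cmeasurable_cst.
pose X1 x := \sum_(i < q) \sum_(0 <= l < (2 * N).+1)
   (\sum_t c t * psi i ((tm t)%:Z - (l%:Z - N%:Z))) * (e i (l%:Z - N%:Z) x)%:C.
pose X2 x := \sum_t c t * (((z (tm t) x)%:C - lag N (tm t) x) + edge N (tm t) x).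
have mX1 : cmeasurable setT X1.
  by apply: cmeasurable_sum => i; exact: cmeasurable_noise.
have mrt t : cmeasurable setT (fun x => ((z (tm t) x)%:C - lag N (tm t) x) + edge N (tm t) x).
  by apply: cmeasurableD => //; exact: (H2 t N (N2N t)).1.
have mX2t t : cmeasurable setT (fun x =>
    c t * (((z (tm t) x)%:C - lag N (tm t) x) + edge N (tm t) x)).
  by apply: cmeasurableM => //; exact: cmeasurable_cst.
have mX2 : cmeasurable setT X2 by exact: cmeasurable_sum.
have XE : (fun x => \sum_t c t * (z (tm t) x)%:C) = (fun x => X1 x + X2 x).
  apply/funext => x; rewrite /X1 /X2.
  under [in RHS]eq_bigr => i _.
    under eq_bigr => l _ do rewrite mulr_suml.
    rewrite exchange_big /=; over.
  rewrite exchange_big -big_split /=; apply: eq_bigr => t _.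
  under eq_bigr => i _ do under eq_bigr => l _ do rewrite -mulrA.
  under eq_bigr => i _ do rewrite -mulr_sumr.
  rewrite -mulr_sumr -mulrDr; congr (_ * _).
  by rewrite lag_lead -/(lead N (tm t) x); ring.
have X1le : (second_moment P X1 <= (q%:R * (s * B))%:E)%E.
  have := @second_moment_sum _ _ _ P _ (index_enum 'I_q) _ _
    (fun i => @cmeasurable_noise _ (index_iota 0 (2 * N).+1) _ (fun l => l%:Z - N%:Z) i)
    (fun i => @second_moment_noise _ (index_iota 0 (2 * N).+1)
      (fun l => \sum_t c t * psi i ((tm t)%:Z - (l%:Z - N%:Z)))
      (fun l => l%:Z - N%:Z) i (iota_uniq _ _) ltac:(by move=> l l'; lia)).
  move=> /le_trans; apply; rewrite size_index_enum card_ord lee_fin ler_wpM2l //.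
  by rewrite -mulr_sumr ler_wpM2l.
have X2le : (second_moment P X2 <= (#|I|%:R * \sum_t normc (c t) ^+ 2 * (C t * eta))%:E)%E.
  have := @second_moment_sum _ _ _ P _ (index_enum I) _ (fun t => normc (c t) ^+ 2 * (C t * eta)) mX2t.
  rewrite size_index_enum; apply => t; apply: second_momentZ => //.
  rewrite [X in X%:E](_ : _ = 2 * (eta + q%:R * (q%:R * (4 * (s * (tm t)%:R))) * eta));
    last by rewrite /C; ring.
  apply: second_momentD => //; first exact: (H2 t N (N2N t)).1.
    exact: H1.
  exact: (H2 t N (N2N t)).2.
rewrite XE; apply: le_trans (second_momentD mX1 mX2 X1le X2le) _.
rewrite -EFinD lee_fin mulrDr lerD2l.
rewrite [leLHS](_ : _ = M * eta); last first.
  by under eq_bigr do rewrite mulrA; rewrite -mulr_suml /M; ring.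
have M1 : 0 < M + 1 by exact: ltr_wpDl.
by rewrite /eta mulrCA ler_piMr ?(ltW del0) // ler_pdivrMr // mul1r lerDl.
Qed.

End LinearProcessMoment.

(** * Integrals against the tapered kernel *)

Section PowerIntegrals.
Context {R : realType}.
Local Notation mu := (@lebesgue_measure R).
Local Open Scope ereal_scope.

(** Monotone convergence: bounds obtained from the fundamental theorem of calculus on compact
    intervals pass to the improper integrals. *)
Lemma integral_bigcup_le (F : (set R)^nat) (f : R -> R) (K : R) :
  nondecreasing_seq F -> (forall i, measurable (F i)) -> measurable_fun setT f ->
  (forall x, 0 <= f x)%R ->
  (forall i, \int[mu]_(x in F i) (f x)%:E <= K%:E) ->
  \int[mu]_(x in \bigcup_i F i) (f x)%:E <= K%:E.
Proof.
move=> nF mF mf f0 FK.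
have h : \int[mu]_(x in F i) (f x)%:E @[i --> \oo] --> \int[mu]_(x in \bigcup_i F i) (f x)%:E.
  apply: ge0_nondecreasing_set_cvg_integral => //.
    by move=> i; apply/measurable_EFinP/measurable_funTS.
  by move=> i x _; rewrite lee_fin.
by apply: (cvge_to_le h); exact: nearW.
Qed.

Lemma integral_powR (x y a : R) : (0 < x)%R -> (x < y)%R -> (a != 0)%R ->
  \int[mu]_(r in `[x, y]) (r `^ (a - 1))%:E = ((y `^ a - x `^ a) / a)%:E.
Proof.
move=> x0 xy a0.
have y0 := lt_trans x0 xy.
have dF (r : R) : (0 < r)%R -> is_derive r (1:R)%R (fun r => r `^ a / a)%R (r `^ (a - 1))%R.
  move=> r0; have h := is_derive1_powR a r0.
  apply: is_derive_eq; rewrite /GRing.scale /=; field; exact: a0.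
have cP (e r : R) : (0 < r)%R -> {for r, continuous (fun r : R => (r `^ e)%R)}.
  move=> r0; apply/differentiable_continuous/derivable1_diffP.
  by apply: derivable_powR; rewrite in_itv /= r0.
have cF (r : R) : (0 < r)%R -> {for r, continuous (fun r : R => r `^ a / a)%R}.
  move=> r0; apply/differentiable_continuous/derivable1_diffP.
  by have := dF r r0 => ?; exact: ex_derive.
rewrite (@continuous_FTC2 _ _ (fun r => r `^ a / a)%R) //.
- by rewrite -EFinB -mulrBl.
- apply: continuous_in_subspaceT => r; rewrite inE /= in_itv /= => /andP[xr _].
  by apply: cP; exact: lt_le_trans xr.
- split.
  + move=> r; rewrite in_itv /= => /andP[xr _].
    by have := dF r (lt_trans x0 xr) => ?; exact: ex_derive.
  + exact/cvg_at_right_filter/cF.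
  + exact/cvg_at_left_filter/cF.
- move=> r; rewrite in_itv /= => /andP[xr _].
  by have := dF r (lt_trans x0 xr) => ?; rewrite derive1E derive_val.
Qed.

Lemma integral_powR0 (b a : R) : (0 < a)%R -> (0 < b)%R ->
  \int[mu]_(r in `]0%R, b]) (r `^ (a - 1))%:E <= (b `^ a / a)%:E.
Proof.
move=> a0 b0.
(* The offset [k.+2] keeps the left end strictly below [b] already for [k = 0], as [integral_powR]
   requires. *)
pose F (k : nat) : set R := `[(b / k.+2%:R)%R, b]%classic.
have bk (k : nat) : (0 < b / k.+2%:R)%R by rewrite divr_gt0.
have FE : \bigcup_i F i = `]0%R, b]%classic.
  apply/seteqP; split => [r [k _]|r].
    by rewrite /F /= !in_itv /= => /andP[h1 ->]; rewrite (lt_le_trans (bk k)).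
  rewrite /= in_itv /= => /andP[r0 rb].
  have [k _ /(_ k (leqnn k))] := near_infty_natSinv_lt (PosNum (divr_gt0 r0 b0)).
  move=> /= hk; exists k => //; rewrite /F /= in_itv /= rb andbT.
  rewrite ler_pdivrMr // -ler_pdivrMl // mulrC.
  have : (k.+2%:R^-1 <= k.+1%:R^-1 :> R)%R by rewrite lef_pV2 ?posrE // ler_nat.
  move=> /le_lt_trans /(_ hk) /ltW; rewrite -[leRHS]invf_div => h.
  by rewrite -lef_pV2 ?posrE ?divr_gt0 // mulrC.
rewrite -FE; apply: integral_bigcup_le.
- apply/nondecreasing_seqP => n; rewrite subsetEset /F => r /=; rewrite !in_itv /=.
  move=> /andP[h ->]; rewrite andbT (le_trans _ h) // ler_pM2l //.
  by rewrite lef_pV2 ?posrE // ler_nat.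
- by move=> i; exact: measurable_itv.
- exact: measurable_powR.
- by move=> r; exact: powR_ge0.
- move=> k; rewrite integral_powR ?gt_eqF // ?lee_fin; last first.
    by rewrite ltr_pdivrMr // ltr_pMr // ltr1n.
  by rewrite ler_pM2r ?invr_gt0 // gerBl powR_ge0.
Qed.

Lemma integral_powRy (b a : R) : (0 < a)%R -> (0 < b)%R ->
  \int[mu]_(r in `]b, +oo[) (r `^ (- a - 1))%:E <= (b `^ (- a) / a)%:E.
Proof.
move=> a0 b0.
pose F (k : nat) : set R := `[b, (b + k.+1%:R)%R]%classic.
apply: (@le_trans _ _ (\int[mu]_(r in \bigcup_i F i) (r `^ (- a - 1))%:E)).
  apply: ge0_subset_integral => //.
  - by apply: bigcup_measurable => k _; exact: measurable_itv.
  - apply/measurable_EFinP/measurable_funTS; exact: measurable_powR.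
  - by move=> r _; rewrite lee_fin powR_ge0.
  move=> r /=; rewrite in_itv /= andbT => br.
  exists (Num.truncn r) => //=; rewrite /F /= in_itv /= ltW //=.
  by rewrite (le_trans (ltW (truncnS_gt r))) // lerDr ltW.
apply: integral_bigcup_le.
- apply/nondecreasing_seqP => n; rewrite subsetEset /F => r /=; rewrite !in_itv /=.
  move=> /andP[-> h] /=; rewrite (le_trans h) // lerD2l ler_nat //.
- by move=> i; exact: measurable_itv.
- exact: measurable_powR.
- by move=> r; exact: powR_ge0.
- move=> k; rewrite integral_powR ?oppr_eq0 ?gt_eqF ?ltrDl // lee_fin.
  by rewrite invrN mulrN -mulNr opprB ler_pM2r ?invr_gt0 // gerBl powR_ge0.
Qed.

Lemma integral_even_le (D : set R) (h : R -> R) : measurable D ->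
  measurable_fun setT h -> (forall r, 0 <= h r)%R ->
  \int[mu]_(w in D) (h `|w|)%:E <= 2%:E * \int[mu]_(w in `[0%R, +oo[) (h w)%:E.
Proof.
move=> mD mh h0.
have mha : measurable_fun setT (fun w : R => (h `|w|)%:E).
  by apply/measurable_EFinP; apply: measurableT_comp => //; exact: normr_measurable.
have ha0 (w : R) : 0 <= (h `|w|)%:E by rewrite lee_fin.
apply: (@le_trans _ _ (\int[mu]_(w in `]-oo, 0%R[ `|` `[0%R, +oo[) (h `|w|)%:E)).
  apply: ge0_subset_integral => //.
  - by apply: measurableU; exact: measurable_itv.
  - exact: measurable_funTS.
  - move=> w _ /=; rewrite !in_itv /= andbT.
    by case: (ltP w 0%R) => _; [left|right].
rewrite ge0_integral_setU //; last 2 first.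
- exact: measurable_funTS.
- rewrite disj_set2E; apply/eqP/seteqP; split => // w [] /=.
  by rewrite !in_itv /= andbT => /lt_le_trans h1 /h1; rewrite ltxx.
have E : \int[mu]_(w in `[0%R, +oo[) (h `|w|)%:E = \int[mu]_(w in `[0%R, +oo[) (h w)%:E.
  apply: eq_integral => w; rewrite inE /= in_itv /= andbT => w0.
  by rewrite ger0_norm.
rewrite mule_natl mule2n E; apply: leeD => //.
rewrite -E ge0_integration_by_substitution0 //.
under [leRHS]eq_integral do rewrite normrN.
apply: ge0_subset_integral => //; first exact: measurable_funTS.
by move=> w /=; rewrite !in_itv /=; exact: ltW.
Qed.

End PowerIntegrals.

Section TaperIntegral.
Context {R : realType}.
Local Notation mu := (@lebesgue_measure R).
Local Notation D := (`[- pi, pi]%classic : set R).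

Lemma integral_restrict_le (B : set R) (f : R -> R) (K : R) : measurable B ->
  measurable_fun setT f -> (forall r, 0 <= f r) ->
  (\int[mu]_(r in B) (f r)%:E <= K%:E)%E ->
  (\int[mu]_(w in D) ((f \_ B) `|w|)%:E <= (2 * K)%:E)%E.
Proof.
move=> mB mf f0 le.
have h0 r : 0 <= (f \_ B) r by rewrite patchE; case: ifP.
have mh : measurable_fun setT (f \_ B).
  by apply/(measurable_restrictT _ mB); exact: measurable_funTS.
apply: le_trans (integral_even_le (measurable_itv _) mh h0) _.
rewrite EFinM; apply: lee_wpmul2l; first by rewrite lee_fin.
apply: le_trans le; rewrite [leRHS]integral_mkcond.
rewrite (_ : (\int[mu]_r _)%E = (\int[mu]_r ((f \_ B) r)%:E)%E); last first.
  by apply: eq_integral => r _; rewrite restrict_EFin.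
apply: ge0_subset_integral => //.
  exact/measurable_EFinP.
by move=> r _; rewrite lee_fin.
Qed.

(** The kernel factor is at most [n^2] for [|w| <= 1 / n], and at most [n^(2 - 2 p) |w|^(- 2 p)]
    elsewhere. The power bound on [g] is used for [|w| < delta]; beyond [delta] the kernel factor is
    at most [n^(2 - 2 p) delta^(- 2 p)] and the integral of [|g|^2] is a constant. *)
Lemma taper_integral_bound (p : nat) (dm A delta : R) (g : R -> R[i]) :
  dm < 2^-1 -> - p%:R + 2^-1 < dm -> 0 < delta -> 0 <= A ->
  square_integrable D g ->
  (forall w, w != 0 -> `|w| <= pi -> `|w| < delta ->
    normc (g w) ^+ 2 <= A * `|w| `^ (- (2 * dm))) ->
  exists2 K : R, 0 <= K & forall n (h : R -> R), (0 < n)%N -> measurable_fun D h ->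
    (forall w, D w -> 0 <= h w) ->
    (forall w, D w ->
      h w <= n%:R ^+ 2 / (1 + n%:R * `|w|) ^+ (2 * p) * normc (g w) ^+ 2) ->
    (\int[mu]_(w in D) (h w)%:E <= (K * n%:R `^ (1 + 2 * dm))%:E)%E.
Proof.
move=> dm1 dmp delta0 A0 [mg1 mg2 gi] gle.
(* The integrands will be [r^(a1 - 1)] near 0 and [r^(- a2 - 1)] at infinity; [0 < a1] and [0 < a2]
   are the two bounds on [dm], and say that these powers are integrable there. *)
pose a1 : R := 1 - 2 * dm; pose a2 : R := 2 * dm + 2 * p%:R - 1.
have a10 : 0 < a1 by rewrite /a1; lra.
have a20 : 0 < a2 by rewrite /a2; lra.
pose G := fine (\int[mu]_(w in D) (normc (g w) ^+ 2)%:E).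
have GE : (\int[mu]_(w in D) (normc (g w) ^+ 2)%:E)%E = G%:E.
  by rewrite /G fineK //; apply: integrable_fin_num => //; exact: gi.
have G0 : 0 <= G by apply: fine_ge0; apply: integral_ge0 => w _; rewrite lee_fin sqr_ge0.
have dV0 : 0 <= delta ^- (2 * p) by rewrite invr_ge0 exprn_ge0 // ltW.
exists (delta ^- (2 * p) * G + 2 * A / a1 + 2 * A / a2).
  by rewrite !addr_ge0 ?mulr_ge0 // ?invr_ge0 ltW.
move=> n f n0 mf f_ge0 fle; have nR : 0 < n%:R :> R by rewrite ltr0n.
pose N : R := n%:R; pose b := N^-1.
have b0 : 0 < b by rewrite invr_gt0.
pose h1 := (fun r : R => r `^ (a1 - 1)) \_ `]0, b]%classic.
pose h2 := (fun r : R => r `^ (- a2 - 1)) \_ `]b, +oo[%classic.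
have h10 r : 0 <= h1 r by rewrite /h1 patchE; case: ifP => // _; exact: powR_ge0.
have h20 r : 0 <= h2 r by rewrite /h2 patchE; case: ifP => // _; exact: powR_ge0.
have mh1 : measurable_fun setT h1.
  have mB : measurable (`]0, b]%classic : set R) by exact: measurable_itv.
  by apply/(measurable_restrictT _ mB)/measurable_funTS; exact: measurable_powR.
have mh2 : measurable_fun setT h2.
  have mB : measurable (`]b, +oo[%classic : set R) by exact: measurable_itv.
  by apply/(measurable_restrictT _ mB)/measurable_funTS; exact: measurable_powR.
have mha (h : R -> R) : measurable_fun setT h -> measurable_fun D (fun w => h `|w|).
  move=> mh; by apply: measurable_funTS; apply: measurableT_comp.
have mD : measurable D by exact: measurable_itv.
have mg := cmeasurable_sqr_normc (conj mg1 mg2).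
pose k1 := delta ^- (2 * p) * N `^ (2 - 2 * p%:R).
pose k2 := N ^+ 2 * A; pose k3 := N `^ (2 - 2 * p%:R) * A.
have k10 : 0 <= k1 by rewrite mulr_ge0 // powR_ge0.
have k20 : 0 <= k2 by rewrite mulr_ge0 // sqr_ge0.
have k30 : 0 <= k3 by rewrite mulr_ge0 // powR_ge0.
have e2 : 2 * p%:R = (2 * p)%:R :> R by rewrite natrM.
have NpE : N ^+ 2 / N ^+ (2 * p) = N `^ (2 - 2 * p%:R).
  have N0 : 0 <= N by exact: ltW.
  rewrite powRB ?(gt_eqF nR) ?implybT // e2.
  by rewrite (powR_mulrn 2 N0) (powR_mulrn (2 * p) N0).
have lehs w : w != 0 -> D w ->
   N ^+ 2 / (1 + N * `|w|) ^+ (2 * p) * normc (g w) ^+ 2 <=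
   k1 * normc (g w) ^+ 2 + k2 * h1 `|w| + k3 * h2 `|w|.
  move=> w0 Dw; have wp : 0 < `|w| by rewrite normr_gt0.
  have wpi : `|w| <= pi by rewrite ler_norml; move: Dw; rewrite /= in_itv.
  have q0 := sqr_ge0 (normc (g w)).
  have Nw0 : 0 < N * `|w| by rewrite mulr_gt0.
  have q1 : 0 <= N ^+ 2 / (1 + N * `|w|) ^+ (2 * p).
    by apply: divr_ge0; [exact: sqr_ge0|rewrite exprn_ge0 // addr_ge0 // ltW].
  have le2 : N ^+ 2 / (1 + N * `|w|) ^+ (2 * p) <= N `^ (2 - 2 * p%:R) / `|w| ^+ (2 * p).
    rewrite -NpE -[leRHS]mulrA -invfM -exprMn ler_wpM2l ?sqr_ge0 //.
    rewrite lef_pV2 ?posrE ?exprn_gt0 // ?addr_gt0 //.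
    by rewrite lerXn2r ?nnegrE ?lerDr // ltW // addr_gt0.
  case: (ltP `|w| delta) => wd; last first.
    rewrite -addrA (@le_trans _ _ (k1 * normc (g w) ^+ 2)) //.
      rewrite ler_wpM2r // (le_trans le2) // /k1 mulrC ler_wpM2r ?powR_ge0 //.
      by rewrite lef_pV2 ?posrE ?exprn_gt0 // lerXn2r ?nnegrE // ltW.
    by rewrite lerDl addr_ge0 // mulr_ge0.
  have gw := gle w w0 wpi wd.
  case: (leP `|w| b) => wb.
    rewrite -addrA addrCA (@le_trans _ _ (k2 * h1 `|w|)) //; last first.
      by rewrite lerDl addr_ge0 // mulr_ge0.
    rewrite /h1 patchE mem_set; last by rewrite /= in_itv /= wp.
    rewrite /k2 -[leRHS]mulrA (_ : a1 - 1 = - (2 * dm)); last by rewrite /a1; lra.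
    apply: (ler_pM q1 q0 _ gw); rewrite ler_pdivrMr ?exprn_gt0 ?addr_gt0 // ler_peMr ?sqr_ge0 //.
    by rewrite exprn_ege1 // lerDl ltW.
  rewrite (@le_trans _ _ (k3 * h2 `|w|)) //; last first.
    by rewrite lerDr addr_ge0 // mulr_ge0 // sqr_ge0.
  rewrite /h2 patchE mem_set; last by rewrite /= in_itv /= wb.
  rewrite (_ : - a2 - 1 = - (2 * p%:R) + - (2 * dm)); last by rewrite /a2; lra.
  rewrite powRD ?(gt_eqF wp) ?implybT // e2 (powR_invn (2 * p) (ltW wp)).
  rewrite /k3 [leRHS]mulrACA.
  exact: (ler_pM q1 q0 le2 gw).
have i1 : (\int[mu]_(w in D) (h1 `|w|)%:E <= (2 * (b `^ a1 / a1))%:E)%E.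
  apply: integral_restrict_le => [||r|]; [exact: measurable_itv|exact: measurable_powR|
    exact: powR_ge0|exact: integral_powR0].
have i2 : (\int[mu]_(w in D) (h2 `|w|)%:E <= (2 * (b `^ (- a2) / a2))%:E)%E.
  apply: integral_restrict_le => [||r|]; [exact: measurable_itv|exact: measurable_powR|
    exact: powR_ge0|exact: integral_powRy].
apply: (@le_trans _ _ (\int[mu]_(w in D)
   ((k1%:E * (normc (g w) ^+ 2)%:E + k2%:E * (h1 `|w|)%:E) + k3%:E * (h2 `|w|)%:E))%E).
  apply: ae_ge0_le_integral => //.
  - exact/measurable_EFinP.
  - move=> w _; rewrite -!EFinM -!EFinD lee_fin !addr_ge0 // mulr_ge0 ?sqr_ge0 //.
  - apply/measurable_EFinP; apply: measurable_funD; last first.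
      by apply: measurable_funM => //; exact: mha.
    apply: measurable_funD; apply: measurable_funM => //; exact: mha.
  (* The bound on [g] is available only for [w != 0], so the comparison is almost everywhere. *)
  - exists [set 0]; split => //; first exact: lebesgue_measure_set1.
    move=> w /= /not_implyP[Dw] /negP; rewrite -!EFinM -!EFinD lee_fin => nle.
    by apply/eqP; apply: contraNT nle => w0; exact: le_trans (fle w Dw) (lehs w w0 Dw).
have mk (k : R) (h : R -> R) : measurable_fun D h ->
    measurable_fun D (fun w => k%:E * (h w)%:E)%E.
  by move=> mh; apply/measurable_EFinP; apply: measurable_funM.
have nk (k : R) (h : R -> R) : 0 <= k -> (forall w, 0 <= h w) ->
    forall w, D w -> (0 <= k%:E * (h w)%:E)%E.
  by move=> k0 h0 w _; rewrite -EFinM lee_fin mulr_ge0.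
have n1 := nk k1 _ k10 (fun v => sqr_ge0 (normc (g v))).
have n2 := nk k2 (fun v => h1 `|v|) k20 (fun v => h10 _).
have n3 := nk k3 (fun v => h2 `|v|) k30 (fun v => h20 _).
have m1 := mk k1 _ mg.
have m2 := mk k2 _ (mha _ mh1).
have m3 := mk k3 _ (mha _ mh2).
have -> : (\int[mu]_(w in D)
     ((k1%:E * (normc (g w) ^+ 2)%:E + k2%:E * (h1 `|w|)%:E) + k3%:E * (h2 `|w|)%:E) =
   \int[mu]_(w in D) (k1%:E * (normc (g w) ^+ 2)%:E) +
   \int[mu]_(w in D) (k2%:E * (h1 `|w|)%:E) + \int[mu]_(w in D) (k3%:E * (h2 `|w|)%:E))%E.
  have e1 := ge0_integralD mu mD (fun w Dw => adde_ge0 (n1 w Dw) (n2 w Dw))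
    (emeasurable_funD m1 m2) n3 m3.
  apply: (etrans e1); congr (_ + _)%E; exact: (ge0_integralD mu mD n1 m1 n2 m2).
have Zl (k : R) (h : R -> R) : 0 <= k -> (forall w, 0 <= h w) -> measurable_fun D h ->
    (\int[mu]_(w in D) (k%:E * (h w)%:E) = k%:E * \int[mu]_(w in D) (h w)%:E)%E.
  move=> k0 h0 mh; apply: ge0_integralZl_EFin => //; last exact/measurable_EFinP.
  by move=> w _; rewrite lee_fin.
rewrite (Zl k1 _ k10 (fun v => sqr_ge0 (normc (g v))) mg).
rewrite (Zl k2 _ k20 (fun v => h10 `|v|) (mha _ mh1)).
rewrite (Zl k3 _ k30 (fun v => h20 `|v|) (mha _ mh2)).
rewrite GE.
apply: (@le_trans _ _ ((k1 * G)%:E + (k2 * (2 * (b `^ a1 / a1)))%:E +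
    (k3 * (2 * (b `^ (- a2) / a2)))%:E)%E).
  apply: leeD; first apply: leeD => //.
    by rewrite [leRHS]EFinM; apply: lee_wpmul2l.
  by rewrite [leRHS]EFinM; apply: lee_wpmul2l.
rewrite -!EFinD lee_fin.
have bE (e : R) : b `^ e = N `^ (- e).
  by rewrite powRN /b -powR_inv1 ?ltW // -powRrM mulN1r powRN.
have E1 : N ^+ 2 * b `^ a1 = N `^ (1 + 2 * dm).
  rewrite bE -powR_mulrn ?ltW // -powRD ?(gt_eqF nR) ?implybT //.
  by congr (_ `^ _); rewrite /a1; lra.
have E2 : N `^ (2 - 2 * p%:R) * b `^ (- a2) = N `^ (1 + 2 * dm).
  rewrite bE opprK -powRD ?(gt_eqF nR) ?implybT //.
  by congr (_ `^ _); rewrite /a2; lra.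
rewrite [leRHS](_ : _ = delta ^- (2 * p) * G * N `^ (1 + 2 * dm) +
    2 * A / a1 * N `^ (1 + 2 * dm) + 2 * A / a2 * N `^ (1 + 2 * dm)); last by rewrite /N; ring.
apply: lerD; first apply: lerD.
(* The part beyond [delta] is of order [n^(2 - 2 p)], and [2 - 2 p <= 1 + 2 dm] follows from
   [0 < a2]. *)
- rewrite /k1 mulrAC ler_wpM2l ?mulr_ge0 // ler_powR ?ler1n //.
  lra.
- by rewrite -E1 /k2 le_eqVlt; apply/orP; left; apply/eqP; ring.
- by rewrite -E2 /k3 le_eqVlt; apply/orP; left; apply/eqP; ring.
Qed.

End TaperIntegral.

Section TaperedTransform.
Context {R : realType}.
Local Notation mu := (@lebesgue_measure R).
Local Notation D := (`[- pi, pi]%classic : set R).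

Lemma pi_le4 : pi <= 4 :> R.
Proof. by have := @pihalf_02_cos_pihalf R; case=> /andP[_]; lra. Qed.

(** The sum is a tapered kernel at [x = e^(i (w_j + w))], so its natural decay is in [|1 - x|].
    Since [|1 - e^(i w_j)| <= 8 m / n] and [|w| / 2 <= |1 - e^(i w)|], one has
    [1 + n |w| <= 2 (1 + 8 m) (1 + n |1 - x|)], whence the constant [M]. *)
Lemma taper_kernel_le (P m : nat) : exists2 C : R, 0 <= C &
  forall (n j : nat) (w : R), (0 < n)%N -> (j <= m)%N -> `|w| <= pi ->
    (1 + n%:R * `|w|) ^+ P.+1 * normc (\sum_(t < n)
      taper n t.+1 ^+ P * cis (fourier_freq n j * t.+1%:R) * cis (t.+1%:R * w)) <= C * n%:R.
Proof.
have [C C0 HC] := @taper_kernel_decay R P.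
pose M : R := 2 * (1 + 8 * m%:R).
exists (M ^+ P.+1 * C) => [|n j w n0 jm wpi].
  by rewrite mulr_ge0 // exprn_ge0 // mulr_ge0 // addr_ge0 // mulr_ge0.
have nR : 0 < n%:R :> R by rewrite ltr0n.
have nn0 : n%:R != 0 :> R by rewrite gt_eqF.
have pp := pi_gt0 R; have p4 := pi_le4.
pose zeta : R[i] := cis (2 * pi / n%:R).
pose x : R[i] := cis (fourier_freq n j + w).
have zn : zeta ^+ n = 1 by rewrite cisX divfK // cis2pi.
have z1 : normc (1 - zeta) <= 8 / n%:R.
  rewrite (le_trans (normc_1Bcis_le _)) // ger0_norm; last by rewrite divr_ge0 // mulr_ge0 // ltW.
  by rewrite ler_pM2r ?invr_gt0 //; lra.
have := HC P n zeta x (leqnn P) n0 (normc_cis _) (normc_cis _) zn z1.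
set y := n%:R * normc (1 - x) => HP.
have -> : \sum_(t < n) taper n t.+1 ^+ P * cis (fourier_freq n j * t.+1%:R) *
    cis (t.+1%:R * w) = (2^-1)%:C ^+ P * taper_kernel P n zeta x.
  rewrite /taper_kernel big_add1 big_mkord mulr_sumr; apply: eq_bigr => t _.
  have -> : x ^+ t.+1 = cis (fourier_freq n j * t.+1%:R) * cis (t.+1%:R * w).
    by rewrite /x cisX mulrDl cisD [w * _]mulrC.
  have -> : zeta ^+ t.+1 = cis (2 * pi * t.+1%:R / n%:R) by rewrite /zeta cisX mulrAC.
  by rewrite /taper exprMn -!mulrA.
have y0 : 0 <= y by rewrite mulr_ge0 ?normc_ge0 // ltW.
have wy : 1 + n%:R * `|w| <= M * (1 + y).
  have h1 := normc_1Bcis_ge wpi.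
  have h2 : normc (1 - cis w) <= normc (1 - x) + 8 * m%:R / n%:R.
    have -> : 1 - cis w = (1 - x) + - (cis w * (1 - cis (fourier_freq n j))).
      by rewrite /x addrC cisD; ring.
    rewrite (le_trans (le_normcD _ _)) // lerD2l normcN normcM normc_cis mul1r.
    rewrite (le_trans (normc_1Bcis_le _)) // /fourier_freq ger0_norm; last first.
      by rewrite divr_ge0 // mulr_ge0 // mulr_ge0 // ltW.
    have pi2 : 0 <= 2 * pi :> R by rewrite mulr_ge0 // ltW.
    have pi8 : 2 * pi <= 8 :> R by lra.
    have jmR : j%:R <= m%:R :> R by rewrite ler_nat.
    by rewrite ler_pM2r ?invr_gt0 //; exact: (ler_pM pi2 (ler0n R j) pi8 jmR).
  have h3 := le_trans h1 h2.
  have := ler_wpM2l (ltW nR) h3; rewrite mulrDr -/y [X in _ + X](_ : _ = 8 * m%:R); last first.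
    by field.
  rewrite mulrA => h4; have m0 : 0 <= m%:R :> R by [].
  have : 0 <= m%:R * y by rewrite mulr_ge0.
  rewrite /M; nra.
have M0 : 0 <= M by rewrite mulr_ge0 // addr_ge0 // mulr_ge0.
have y1 : 0 <= 1 + y by rewrite addr_ge0.
have w1 : 0 <= 1 + n%:R * `|w| by rewrite addr_ge0 // mulr_ge0.
have le1 : (1 + n%:R * `|w|) ^+ P.+1 <= (M * (1 + y)) ^+ P.+1.
  by rewrite lerXn2r ?nnegrE // mulr_ge0.
have le2 : normc ((2^-1)%:C ^+ P * taper_kernel P n zeta x) <= normc (taper_kernel P n zeta x).
  rewrite normcM ler_piMl ?normc_ge0 // normcX normc_real ger0_norm // exprn_ile1 //.
  by rewrite invf_le1 // ler1n.
apply: le_trans (ler_pM (exprn_ge0 _ w1) (normc_ge0 _) le1 le2) _.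
by rewrite exprMn -!mulrA ler_wpM2l // exprn_ge0.
Qed.

Lemma fourier_shift (g : R -> R[i]) (t k : int) :
  fourier (fun w => cis (t%:~R * w) * g w) k = fourier g (t + k).
Proof.
rewrite /fourier; congr (_ * cintegral _ _); apply/funext => w.
by rewrite mulrA -cisD -mulrDl -intrD addrC.
Qed.

Lemma fourier_trig (g : R -> R[i]) (I : finType) (tm : I -> nat) (c : I -> R[i]) (k : int) :
  square_integrable D g ->
  \sum_t c t * fourier g ((tm t)%:Z + k) =
  fourier (fun w => (\sum_t c t * cis ((tm t)%:R * w)) * g w) k.
Proof.
move=> gi.
rewrite (_ : (fun w => _ * g w) =
    (fun w => \sum_t c t * (cis ((tm t)%:~R * w) * g w))); last first.
  apply/funext => w; rewrite mulr_suml; apply: eq_bigr => t _.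
  by rewrite mulrA.
rewrite fourier_sum => [|t]; first by apply: eq_bigr => t _; rewrite fourier_shift.
apply: (@square_integrableM _ _ _ _ 1) => //; first exact: cmeasurable_cis.
by move=> w _; rewrite normc_cis.
Qed.

(** Multiplication by an exponential shifts Fourier coefficients, so the inner sums are Fourier
    coefficients of [g] times a trigonometric polynomial, at distinct frequencies. *)
Lemma bessel_trig (g : R -> R[i]) (I : finType) (tm : I -> nat) (c : I -> R[i]) (N : nat) :
  square_integrable D g ->
  \sum_(0 <= l < (2 * N).+1)
     normc (\sum_t c t * fourier g ((tm t)%:Z - (l%:Z - N%:Z))) ^+ 2 <=
  (2 * pi)^-1 * \int[mu]_(w in D)
    (normc ((\sum_t c t * cis ((tm t)%:R * w)) * g w) ^+ 2).
Proof.
move=> gi; pose h w := (\sum_t c t * cis ((tm t)%:R * w)) * g w.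
have hi : square_integrable D h.
  apply: (@square_integrableM _ _ _ _ (\sum_t normc (c t))) => //.
    apply: cmeasurable_sum => t; apply: cmeasurableM; first exact: cmeasurable_cst.
    exact: cmeasurable_cis.
  move=> w _; rewrite (le_trans (le_normc_sum _ _)) // ler_sum // => t _.
  by rewrite normcM normc_cis mulr1.
pose u (l : nat) : int := - (l%:Z - N%:Z).
have := @bessel R h [seq u l | l <- index_iota 0 (2 * N).+1] hi.
rewrite map_inj_uniq ?iota_uniq; last by move=> l l'; rewrite /u; lia.
move=> /(_ isT); rewrite big_map; apply: le_trans.
by rewrite le_eqVlt; apply/orP; left; apply/eqP; apply: eq_bigr => l _; rewrite fourier_trig.
Qed.

(** The Riemann-Lebesgue lemma in the square integrable case: by Bessel's inequality the squared
    coefficients are summable along the nonnegative and along the negative integers. *)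
Lemma fourier_cvg0 (g : R -> R[i]) (eta : R) : square_integrable D g -> 0 < eta ->
  exists K : nat, forall k : int, (K <= `|k|)%N -> normc (fourier g k) ^+ 2 <= eta.
Proof.
move=> gi eta0.
have key (u : nat -> int) : injective u ->
    exists K : nat, forall k, (K <= k)%N -> normc (fourier g (u k)) ^+ 2 <= eta.
  move=> uI; pose a k := normc (fourier g (u k)) ^+ 2.
  have ca : cvgn (series a).
    apply: nondecreasing_is_cvgn.
      by apply: nondecreasing_series => k _ _; exact: sqr_ge0.
    exists ((2 * pi)^-1 * \int[mu]_(w in D) (normc (g w) ^+ 2)) => _ [N _ <-].
    have := @bessel R g [seq u l | l <- index_iota 0 N] gi.
    by rewrite map_inj_uniq // iota_uniq => /(_ isT); rewrite big_map.
  have /cvgrPdist_lt/(_ _ eta0)[K _ HK] := cvg_series_cvg_0 ca.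
  exists K => k Kk; have := HK k Kk.
  by rewrite sub0r normrN ger0_norm ?sqr_ge0 //; exact: ltW.
have [K1 H1] := key Posz (fun x y => ltac:(by case)).
have [K2 H2] := key Negz (fun x y => ltac:(by case)).
exists (K1 + K2.+1)%N => -[k|k] /= hk.
  by apply: H1; rewrite (leq_trans _ hk) // leq_addr.
by apply: H2; rewrite -ltnS (leq_trans _ hk) // leq_addl.
Qed.

End TaperedTransform.

(** * The tapered Fourier transform of a linear process *)

Lemma fine_le_EFin (R : realDomainType) (x : \bar R) (r : R) :
  (0 <= x)%E -> (x <= r%:E)%E -> fine x <= r.
Proof. by case: x => [x|//|//] _; rewrite lee_fin. Qed.

Section TransformMoment.
Context {R : realType} {d : measure_display} {T : measurableType d}.
Variable P : probability T R.
Local Notation mu := (@lebesgue_measure R).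
Local Notation D := (`[- pi, pi]%classic : set R).
Variables (q : nat) (e : 'I_q -> int -> T -> R) (sg : 'I_q -> R) (s : R).
Hypothesis me : forall i u, measurable_fun setT (e i u).
Hypothesis ie : forall i u v, P.-integrable setT (fun x => (e i u x * e i v x)%:E).
Hypothesis e2 : forall i u, (\int[P]_x (e i u x * e i u x)%:E)%E = (sg i)%:E.
Hypothesis eo : forall i u v, u != v -> (\int[P]_x (e i u x * e i v x)%:E)%E = 0%E.
Hypothesis sgs : forall i, sg i <= s.
Hypothesis s0 : 0 <= s.
Variable g : 'I_q -> R -> R[i].
Hypothesis gi : forall i, square_integrable D (g i).
Variable z : nat -> T -> R.
Hypothesis mz : forall t, measurable_fun setT (z t).
Hypothesis hz : forall (t : nat) (eta : R), 0 < eta -> exists N0 : nat,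
  forall N, (N0 <= N)%N ->
    (second_moment P (fun x => ((z t x)%:C - \sum_(i < q) \sum_(0 <= l < (2 * N).+1)
      fourier (g i) (l%:Z - N%:Z) * (e i (t%:Z - (l%:Z - N%:Z)) x)%:C)%R) <= eta%:E)%E.
Variables (p : nat) (dm : R).
Hypothesis p1 : (1 <= p)%N.
Hypothesis dm1 : dm < 2^-1.
Hypothesis dmp : - p%:R + 2^-1 < dm.
Hypothesis g0 : forall i, exists delta A : R, [/\ 0 < delta, 0 <= A &
  forall w, w != 0 -> `|w| <= pi -> `|w| < delta ->
    normc (g i w) ^+ 2 <= A * `|w| `^ (- (2 * dm))].

Let mD : measurable D. Proof. exact: measurable_itv. Qed.

(* The factor [C] of the kernel bound is moved into [g], so that [taper_integral_bound]
   applies to [C * g]. *)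
Lemma dft_second_moment (m : nat) : exists2 K : R, 0 <= K &
  forall n j, (1 < n)%N -> (j <= m)%N ->
  (second_moment P (fun x =>
    ((Num.sqrt (2 * pi * \sum_(1 <= t < n.+1) normc (taper n t ^+ p.-1) ^+ 2))^-1)%:C *
    \sum_(1 <= t < n.+1) (taper n t ^+ p.-1 * cis (fourier_freq n j * t%:R)) * (z t x)%:C)%R
   <= (K * n%:R `^ (2 * dm))%:E)%E.
Proof.
case: p p1 dmp => // P' _ dmp' /=.
have [C C0 HC] := @taper_kernel_le R P' m.
have gCi i : square_integrable D (fun w => C%:C * g i w).
  apply: (@square_integrableM _ _ (fun=> C%:C) _ C mD (cmeasurable_cst D _) _ (gi i)).
  by move=> w _; rewrite normc_real ger0_norm.
have /choice[K HK] : forall i, exists K : R, 0 <= K /\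
    forall n (h : R -> R), (0 < n)%N -> measurable_fun D h ->
    (forall w, D w -> 0 <= h w) ->
    (forall w, D w ->
      h w <= n%:R ^+ 2 / (1 + n%:R * `|w|) ^+ (2 * P'.+1) * normc (C%:C * g i w) ^+ 2) ->
    (\int[mu]_(w in D) (h w)%:E <= (K * n%:R `^ (1 + 2 * dm))%:E)%E.
  move=> i; have [delta [A [delta0 A0 gA]]] := g0 i.
  have CA0 : 0 <= C ^+ 2 * A by rewrite mulr_ge0 // sqr_ge0.
  have CgA w : w != 0 -> `|w| <= pi -> `|w| < delta ->
      normc (C%:C * g i w) ^+ 2 <= C ^+ 2 * A * `|w| `^ (- (2 * dm)).
    move=> w0 wpi wd; rewrite normcM normc_real exprMn real_normK ?num_real //.
    by rewrite -mulrA ler_wpM2l ?sqr_ge0 // gA.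
  have [K K0 HK] := taper_integral_bound dm1 dmp' delta0 CA0 (gCi i) CgA.
  by exists K.
pose B := (2 * pi)^-1 * \sum_i K i.
have pi2 : 0 < 2 * pi :> R by rewrite mulr_gt0 // pi_gt0.
have B0 : 0 <= B.
  rewrite mulr_ge0 ?invr_ge0 ?(ltW pi2) // sumr_ge0 // => i _; exact: (HK i).1.
(* The first factor comes from the normalisation of the transform, whose remaining [1 / n] lowers
   the exponent [1 + 2 dm] to [2 dm]; the second is the bound of [second_moment_linear]. *)
exists (2 ^+ P' / (2 * pi) * (2 * (q%:R * (s * B)))) => [|n j n1 jm].
  apply: mulr_ge0; first by rewrite divr_ge0 ?exprn_ge0 ?(ltW pi2).
  by do 2![apply: mulr_ge0 => //]; exact: mulr_ge0.
have n0 : (0 < n)%N by rewrite (ltn_trans _ n1).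
have nR : 0 < n%:R :> R by rewrite ltr0n.
pose c (t : 'I_n) : R[i] := taper n t.+1 ^+ P' * cis (fourier_freq n j * t.+1%:R).
pose H w : R[i] := \sum_t c t * cis (t.+1%:R * w).
have mH : cmeasurable D H.
  apply: cmeasurable_sum => t; apply: cmeasurableM; first exact: cmeasurable_cst.
  exact: cmeasurable_cis.
have mom : (second_moment P (fun x => \sum_(t < n) c t * (z t.+1 x)%:C)%R <=
    (2 * (q%:R * (s * (B * n%:R `^ (1 + 2 * dm)))))%:E)%E.
  apply: (second_moment_linear me ie e2 eo sgs s0 _ mz hz) => [i eta eta0|N].
    exact: fourier_cvg0.
  rewrite /B -mulrA mulr_suml mulr_sumr; apply: ler_sum => i _.
  apply: (le_trans (bessel_trig (fun t : 'I_n => t.+1) c N (gi i))).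
  rewrite ler_wpM2l ?invr_ge0 ?(ltW pi2) // -/H.
  apply: fine_le_EFin; first by apply: integral_ge0 => w _; rewrite lee_fin sqr_ge0.
  apply: (HK i).2 => // [|w _|w Dw].
  - apply: cmeasurable_sqr_normc; apply: cmeasurableM => //.
    by case: (gi i) => ? ? _; split.
  - exact: sqr_ge0.
  have wpi : `|w| <= pi by rewrite ler_norml; move: Dw; rewrite /= in_itv.
  have w1 : 0 < 1 + n%:R * `|w| by rewrite ltr_pwDl // mulr_ge0 // ltW.
  have := HC n j w n0 jm wpi; rewrite -/(H w) => Hle.
  rewrite !normcM !exprMn normc_real [X in _ <= _ * (X * _)](_ : _ = C ^+ 2); last first.
    by rewrite real_normK ?num_real.
  rewrite mulrA ler_wpM2r ?sqr_ge0 // mulrAC ler_pdivlMr ?exprn_gt0 //.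
  rewrite mulnC exprM -exprMn -exprMn mulrC [leRHS](_ : _ = (C * n%:R) ^+ 2); last first.
    by congr (_ ^+ 2); rewrite mulrC.
  rewrite lerXn2r ?nnegrE ?mulr_ge0 ?normc_ge0 ?exprn_ge0 ?(ltW w1) //.
rewrite (_ : (fun x => _ * \sum_(1 <= t < n.+1) _) = (fun x => 
    ((Num.sqrt (2 * pi * \sum_(1 <= t < n.+1) normc (taper n t ^+ P') ^+ 2))^-1)%:C *
    \sum_(t < n) c t * (z t.+1 x)%:C)); last first.
  by apply/funext => x; congr (_ * _); rewrite big_add1 big_mkord.
set S := \sum_(1 <= t < n.+1) _.
have mY : cmeasurable setT (fun x => \sum_(t < n) c t * (z t.+1 x)%:C).
  apply: cmeasurable_sum => t; apply: cmeasurableM; first exact: cmeasurable_cst.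
  exact: cmeasurable_real.
apply: (le_trans (second_momentZ _ mY mom)); rewrite lee_fin.
have S0 : n%:R / 2 ^+ P' <= S by exact: sum_taper_ge.
have Sp : 0 < S by rewrite (lt_le_trans _ S0) // divr_gt0 // exprn_gt0.
rewrite normc_real real_normK ?num_real // exprVn sqr_sqrtr //; last exact: (mulr_ge0 (ltW pi2) (ltW Sp)).
have SV : (2 * pi * S)^-1 <= 2 ^+ P' / (2 * pi) * n%:R^-1.
  rewrite invfM mulrC [leRHS](_ : _ = (n%:R / 2 ^+ P')^-1 * (2 * pi)^-1); last first.
    by rewrite invf_div; ring.
  rewrite ler_wpM2r ?invr_ge0 ?(ltW pi2) // lef_pV2 ?posrE // divr_gt0 // exprn_gt0 //.
have E : n%:R^-1 * n%:R `^ (1 + 2 * dm) = n%:R `^ (2 * dm) :> R.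
  rewrite powRD ?(gt_eqF nR) ?implybT // powRr1 ?ltW // mulKf // gt_eqF //.
rewrite -E [leRHS](_ : _ = 2 ^+ P' / (2 * pi) * n%:R^-1 *
   (2 * (q%:R * (s * (B * n%:R `^ (1 + 2 * dm)))))); last by ring.
have nn : 0 <= 2 * (q%:R * (s * (B * n%:R `^ (1 + 2 * dm)))).
  by do 3![apply: mulr_ge0 => //]; apply: mulr_ge0 => //; exact: powR_ge0.
exact: (ler_wpM2r nn SV).
Qed.

End TransformMoment.

(** * Quadratic forms of Gram matrices *)

Section GramForm.
Context {R : realType}.

Lemma cmxM (m n k : nat) (A : 'M[R]_(m, n)) (B : 'M[R]_(n, k)) :
  cmx (A *m B) = cmx A *m cmx B.
Proof. exact: map_mxM. Qed.

Lemma cmx_sum (m n : nat) (I : Type) (r : seq I) (F : I -> 'M[R]_(m, n)) :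
  cmx (\sum_(i <- r) F i) = \sum_(i <- r) cmx (F i).
Proof. exact: raddf_sum. Qed.

Lemma mulc_conj (x : R[i]) : x * x^*%C = (normc x ^+ 2)%:C.
Proof.
apply/eqP; rewrite eq_complex sqr_normcE; case: x => a b /=.
by apply/andP; split; apply/eqP; ring.
Qed.

Lemma conjmx_row (q : nat) (v : 'rV[R[i]]_q) (w : 'cV[R]_q) :
  ((cmx w)^T *m v ^t*) 0 0 = ((v *m cmx w) 0 0)^*%C.
Proof.
rewrite !mxE conjc_sum; apply: eq_bigr => i _; rewrite !mxE conjcM mulrC.
by congr (_ * _); exact/esym/conjc_real.
Qed.

Lemma gram_quad (I : Type) (r : seq I) (q : nat) (w : I -> 'cV[R]_q) (v : 'rV[R[i]]_q) :
  (v *m cmx (\sum_(i <- r) w i *m (w i)^T) *m v ^t*) 0 0 =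
  (\sum_(i <- r) normc ((v *m cmx (w i)) 0 0) ^+ 2)%:C.
Proof.
rewrite cmx_sum mulmx_sumr mulmx_suml summxE rmorph_sum; apply: eq_bigr => i _.
rewrite cmxM -(_ : (cmx (w i))^T = cmx (w i)^T); last exact: map_trmx.
rewrite mulmxA -mulmxA mxE big_ord1 conjmx_row.
exact: mulc_conj.
Qed.

Lemma gram_sym (I : Type) (r : seq I) (q : nat) (w : I -> 'cV[R]_q) :
  (\sum_(i <- r) w i *m (w i)^T)^T = \sum_(i <- r) w i *m (w i)^T.
Proof.
rewrite raddf_sum; apply: eq_bigr => i _ /=.
by rewrite trmx_mul trmxK.
Qed.

Lemma gram_psd (I : Type) (r : seq I) (q : nat) (w : I -> 'cV[R]_q) (v : 'rV[R]_q) :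
  0 <= (v *m (\sum_(i <- r) w i *m (w i)^T) *m v^T) 0 0.
Proof.
rewrite mulmx_sumr mulmx_suml summxE sumr_ge0 // => i _.
rewrite mulmxA -mulmxA mxE big_ord1.
have -> : ((w i)^T *m v^T) 0 0 = (v *m w i) 0 0 by rewrite -trmx_mul mxE.
by rewrite -expr2 sqr_ge0.
Qed.

(** The row [v A] vanishes on the first [c] coordinates, so [v A x_i] sees only the others.
    Cauchy-Schwarz is used twice, for [v A] and for its product with [x_i], each time at the cost of
    a factor [q]. *)
Lemma gram_kernel_le (I : Type) (r : seq I) (q c : nat) (hc : (c <= q)%N)
    (A : 'M[R]_q) (x : I -> 'cV[R]_q) (v : 'rV[R[i]]_q) :
  v *m cmx (\matrix_(a < q, l < c) A a (widen_ord hc l)) = 0 ->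
  (v *m cmx (\sum_(i <- r) (A *m x i) *m (A *m x i)^T) *m v ^t*) 0 0 <=
  (q%:R ^+ 2 * (\sum_a \sum_b A a b ^+ 2) *
     \sum_(i <- r) \sum_(b < q | (c <= b)%N) x i b 0 ^+ 2)%:C * (v *m v ^t*) 0 0.
Proof.
move=> vA; rewrite gram_quad.
have -> : (v *m v ^t*) 0 0 = (\sum_a normc (v 0 a) ^+ 2)%:C.
  rewrite mxE rmorph_sum; apply: eq_bigr => a _; rewrite !mxE.
  exact: mulc_conj.
rewrite -rmorphM lecR.
set V := \sum_a normc (v 0 a) ^+ 2; set F := \sum_a _.
have F0 : 0 <= F by rewrite sumr_ge0 // => a _; rewrite sumr_ge0 // => b _; exact: sqr_ge0.
have V0 : 0 <= V by rewrite sumr_ge0 // => a _; exact: sqr_ge0.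
pose u := v *m cmx A.
have u0 (b : 'I_q) : (b < c)%N -> u 0 b = 0.
  move=> bc; have /matrixP/(_ 0 (Ordinal bc)) := vA; rewrite !mxE => h.
  rewrite -[RHS]h; apply: eq_bigr => a _; rewrite !mxE; congr (_ * (A _ _)%:C).
  exact: val_inj.
have uF b : normc (u 0 b) ^+ 2 <= q%:R * F * V.
  rewrite mxE (le_trans (sqr_normc_sum_le _ _)) // size_index_enum card_ord -mulrA ler_wpM2l //.
  rewrite /V mulr_sumr; apply: ler_sum => a _.
  rewrite normcM exprMn mulrC ler_wpM2r ?sqr_ge0 // mxE normc_real real_normK ?num_real //.
  rewrite /F (bigD1 a) //= (bigD1 b) //= -addrA lerDl addr_ge0 //.
    by rewrite sumr_ge0 // => *; exact: sqr_ge0.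
  by rewrite sumr_ge0 // => *; rewrite sumr_ge0 // => *; exact: sqr_ge0.
rewrite mulrAC mulr_sumr; apply: ler_sum => i _.
have -> : (v *m cmx (A *m x i)) 0 0 = \sum_(b < q | (c <= b)%N) u 0 b * (x i b 0)%:C.
  rewrite cmxM mulmxA -/u mxE.
  rewrite [LHS](bigID (fun b : 'I_q => (c <= b)%N)) /= [X in _ + X]big1 ?addr0.
    by apply: eq_bigr => b _; rewrite !mxE.
  by move=> b; rewrite -ltnNge => /u0 ->; rewrite mul0r.
rewrite -big_filter (le_trans (sqr_normc_sum_le _ _)) //.
have sz : (size [seq b : 'I_q <- index_enum 'I_q | (c <= b)%N])%:R <= q%:R :> R.
  by rewrite ler_nat size_filter (leq_trans (count_size _ _)) // size_index_enum card_ord.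
rewrite -[X in _ <= _ * X]big_filter expr2 -!mulrA; apply: ler_pM => //.
  by rewrite sumr_ge0 // => b _; exact: sqr_ge0.
rewrite !mulrA mulr_sumr; apply: ler_sum => b _.
by rewrite normcM exprMn normc_real real_normK ?num_real // ler_wpM2r // sqr_ge0.
Qed.

End GramForm.

(** * Blocks of coordinates, and the transfer function near frequency zero *)

Section BlocksAndSpectrum.
Context {R : realType}.

Lemma in_block_from (a : nat -> nat) (k s i : nat) :
  (\sum_(l < k) a l <= i)%N -> (i < \sum_(l < s.+1) a l)%N ->
  exists h, [/\ (k <= h)%N, (h <= s)%N & in_block a h i].
Proof.
move=> ki is_.
have mono x y : (x <= y)%N -> (\sum_(l < x) a l <= \sum_(l < y) a l)%N.
  by move=> xy; rewrite -!(big_mkord predT a) (big_cat_nat _ xy) // leq_addr.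
pose p h := (i < \sum_(l < h.+1) a l)%N.
have exp : exists h, p h by exists s.
case: (ex_minnP exp) => h ph hmin; exists h; split; last 1 first.
- rewrite /in_block; apply/andP; split=> //.
  case: h ph hmin => [|h] ph hmin; first by rewrite big_ord0.
  rewrite leqNgt; apply/negP => hh; have := hmin h hh; by rewrite ltnn.
- rewrite leqNgt; apply/negP => hk.
  have := leq_trans ph (leq_trans (mono _ _ hk) ki); by rewrite ltnn.
- exact: hmin.
Qed.

(** Used to replace [|1 - e^(- i w)|] by [|w|] under a power of either sign; the constant covers
    negative exponents. *)
Lemma powR_comparable (x y e : R) : 0 < x -> x / 2 <= y -> y <= x ->
  y `^ e <= 2 `^ `|e| * x `^ e.
Proof.
move=> x0 xy yx.
have y0 : 0 < y by rewrite (lt_le_trans _ xy) // divr_gt0.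
case: (leP 0 e) => e0.
  rewrite (@le_trans _ _ (x `^ e)) //; first by rewrite ge0_ler_powR // nnegrE ltW.
  have one : 1 `^ `|e| = 1 :> R by rewrite powR1.
  rewrite ler_peMl ?powR_ge0 // -[X in X <= _]one.
  by rewrite ge0_ler_powR // ?nnegrE // ler1n.
have -> : 2 `^ `|e| * x `^ e = (x / 2) `^ e :> R.
  rewrite powRM ?invr_ge0 ?ltW // mulrC; congr (_ * _).
  by rewrite ltr0_norm // -powR_inv1 // -powRrM mulN1r.
have -> : e = - (- e) by rewrite opprK.
rewrite !(powRN _ (- e)) lef_pV2 ?posrE ?powR_gt0 ?divr_gt0 //.
apply: ge0_ler_powR => //; rewrite ?nnegrE ?oppr_ge0; [exact: ltW|exact: divr_ge0 (ltW x0) _|exact: ltW].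
Qed.

Lemma normc_fracdiff (d w : R) :
  normc (fracdiff d w) = normc (1 - cis (- w)) `^ (- d).
Proof.
by rewrite /fracdiff /cpow normcM normc_cis mulr1 normc_real ger0_norm // powR_ge0.
Qed.

Lemma near0_fracdiff_le (d dm : R) (tau phi : R -> R) (f : R -> R[i]) :
  d <= dm -> C1_near0 tau ->
  (forall w, - pi <= w <= pi -> w != 0 ->
    f w = fracdiff d w * (tau w)%:C * cis (phi w)) ->
  exists delta A : R, [/\ 0 < delta, 0 <= A &
    forall w, w != 0 -> `|w| <= pi -> `|w| < delta ->
      normc (f w) ^+ 2 <= A * `|w| `^ (- (2 * dm))].
Proof.
move=> ddm [del del0 tauC1] fE.
have [tau0 _] := tauC1 0 (ltac:(by rewrite normr0)).
have ctau : {for 0, continuous tau}.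
  exact/differentiable_continuous/derivable1_diffP.
have /cvgrPdist_lt/(_ 1 ltr01) := ctau; rewrite near_simpl.
move=> /nbhs_ballP[delta /= delta0 Hd].
pose M := `|tau 0| + 1.
exists delta, (2 `^ (2 * (dm - d)) * 2 `^ `|- (2 * dm)| * M ^+ 2); split => //.
  by rewrite mulr_ge0 ?sqr_ge0 // mulr_ge0 // powR_ge0.
move=> w w0 wpi wd; rewrite fE //; last by rewrite -ler_norml.
rewrite normcM normc_cis mulr1 normcM normc_fracdiff normc_real exprMn.
have tauM : `|tau w| ^+ 2 <= M ^+ 2.
  rewrite lerXn2r ?nnegrE ?addr_ge0 //.
  have : ball 0 delta w by rewrite /ball /= sub0r normrN.
  move=> /Hd /= h; rewrite /M.
  have := ler_normB (tau 0) (tau 0 - tau w); rewrite opprB addrC subrK => h2.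
  by rewrite (le_trans h2) // lerD2l ltW.
set y := normc _; have wp : 0 < `|w| by rewrite normr_gt0.
have yle : y <= `|w| by rewrite -[leRHS]normrN; exact: normc_1Bcis_le.
have yge : `|w| / 2 <= y by rewrite -[X in X / 2]normrN; apply: normc_1Bcis_ge; rewrite normrN.
have y0 : 0 < y by rewrite (lt_le_trans _ yge) // divr_gt0.
have y2 : y <= 2.
  by rewrite (le_trans (le_normcD _ _)) // normcN normc_cis normc1.
rewrite [leRHS]mulrAC; apply: ler_pM => //; rewrite ?sqr_ge0 //.
rewrite -powR_mulrn ?powR_ge0 // -powRrM.
(* With [y = |1 - e^(- i w)|], the excess power [y^(2 (dm - d))] has a nonnegative exponent and is
   bounded through [y <= 2]; the rest is comparable with [|w|^(- 2 dm)]. *)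
rewrite (_ : - d * 2 = 2 * (dm - d) + - (2 * dm)); last by ring.
rewrite powRD ?(gt_eqF y0) ?implybT // -mulrA.
apply: ler_pM; rewrite ?powR_ge0 //; last exact: powR_comparable.
by rewrite ge0_ler_powR ?nnegrE // ?(ltW y0) // mulr_ge0 // subr_ge0.
Qed.

End BlocksAndSpectrum.

(** * Moments of the innovations *)

Section Innovations.
Context {R : realType} {d : measure_display} {T : measurableType d}.
Variables (P : probability T R) (q : nat) (eps : int -> {RV P >-> q.-tuple R}).

Lemma measurable_coord (X : {RV P >-> q.-tuple R}) (i : 'I_q) :
  measurable_fun setT (fun x => tnth (X x) i).
Proof.
apply: (@measurableT_comp _ _ _ _ _ _ (fun y : q.-tuple R => tnth y i)) => //.
exact: measurable_tnth.
Qed.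

(** With [S] the squared norm of the vector, the fourth moment makes [S^2] integrable, and each
    squared coordinate is at most [1 + S^2]; products follow from [2 |X Y| <= X^2 + Y^2]. *)
Lemma integrable_coord_mul (i : 'I_q) :
  (forall t, ('E_P[fun x => ((\sum_(i < q) tnth (eps t x) i ^+ 2) ^+ 2)%R] < +oo)%E) ->
  forall u v, P.-integrable setT (fun x => (tnth (eps u x) i * tnth (eps v x) i)%:E).
Proof.
move=> heps_4 u v.
pose S t x := \sum_(l < q) tnth (eps t x) l ^+ 2.
have mS t : measurable_fun setT (S t).
  apply: measurable_sum => l; apply: measurable_funX; exact: measurable_coord.
have iS t : P.-integrable setT (EFin \o (fun x => S t x ^+ 2)).
  apply/integrableP; split; first by apply/measurable_EFinP; exact: measurable_funX.
  have := heps_4 t; rewrite unlock; apply: le_lt_trans.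
  rewrite le_eqVlt; apply/orP; left; apply/eqP; apply: eq_integral => x _ /=.
  by rewrite ger0_norm // sqr_ge0.
have i1 : P.-integrable setT (EFin \o (fun=> 2 : R)).
  exact: finite_measure_integrable_cst.
have dom : P.-integrable setT (fun x => (2%:E + ((S u x ^+ 2)%:E + (S v x ^+ 2)%:E))%E).
  apply: (integrableD _ i1) => //; exact: (integrableD _ (iS u) (iS v)).
apply: le_integrable dom => //.
  by apply/measurable_EFinP; apply: measurable_funM; exact: measurable_coord.
move=> x _; rewrite -!EFinD lee_fin.
have bnd t : tnth (eps t x) i ^+ 2 <= 1 + S t x ^+ 2.
  have h : tnth (eps t x) i ^+ 2 <= S t x.
    by rewrite /S (bigD1 i) //= lerDl sumr_ge0 // => *; exact: sqr_ge0.
  have := sqr_ge0 (S t x - 1); have := sqr_ge0 (tnth (eps t x) i); move: h; nra.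
rewrite [leRHS]ger0_norm; last by rewrite addr_ge0 // addr_ge0 // sqr_ge0.
have := bnd u; have := bnd v.
move: (tnth (eps u x) i) (tnth (eps v x) i) (S u x ^+ 2) (S v x ^+ 2) => X Y s1 s2 h1 h2.
have := sqr_ge0 (X - Y); have := sqr_ge0 (X + Y).
by rewrite ler_norml => h3 h4; apply/andP; split; nra.
Qed.

Lemma integral_coord (i : 'I_q) (t : int) :
  ('E_P[fun x => tnth (eps t x) i] = 0%R%:E)%E ->
  (\int[P]_x (tnth (eps t x) i)%:E = 0)%E.
Proof. by rewrite unlock. Qed.

Lemma integral_coord_sqr (i : 'I_q) (t : int) (c : R) :
  ('E_P[fun x => tnth (eps t x) i] = 0%R%:E)%E ->
  covariance P (fun x => tnth (eps t x) i) (fun x => tnth (eps t x) i) = c%:E ->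
  (\int[P]_x (tnth (eps t x) i * tnth (eps t x) i)%:E = c%:E)%E.
Proof.
move=> E0; rewrite unlock E0 /= unlock => <-.
apply: eq_integral => x _.
change ((tnth (eps t x) i * tnth (eps t x) i)%:E =
  ((tnth (eps t x) i - 0) * (tnth (eps t x) i - 0))%:E).
by rewrite subr0.
Qed.

Lemma integral_coord_orth (i : 'I_q) (u v : int) :
  independent_family eps ->
  (forall t, ('E_P[fun x => tnth (eps t x) i] = 0%R%:E)%E) ->
  (forall u v, P.-integrable setT (fun x => (tnth (eps u x) i * tnth (eps v x) i)%:E)) ->
  u != v ->
  (\int[P]_x (tnth (eps u x) i * tnth (eps v x) i)%:E = 0)%E.
Proof.
move=> indep E0 iM uv.
pose X t : {mfun T >-> R} := mfun_Sub (mem_set (measurable_coord (eps t) i)).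
have iX t : P.-integrable setT (EFin \o X t).
  have i1 : P.-integrable setT (EFin \o (fun=> 1 : R)).
    exact: finite_measure_integrable_cst.
  have dom : P.-integrable setT (fun x => (1%:E + (tnth (eps t x) i * tnth (eps t x) i)%:E)%E).
    exact: (integrableD _ i1 (iM t t)).
  apply: le_integrable dom => //; first exact/measurable_EFinP/measurable_coord.
  move=> x _; rewrite -EFinD lee_fin [leRHS]ger0_norm; last first.
    by rewrite addr_ge0 // -expr2 sqr_ge0.
  change (`|tnth (eps t x) i| <= 1 + tnth (eps t x) i * tnth (eps t x) i).
  move: (tnth _ _) => y; have := sqr_ge0 (y - 1); have := sqr_ge0 (y + 1).
  by rewrite ler_norml => h1 h2; apply/andP; split; nra.
apply: (@integral_indep_mul0 _ _ _ P (X u) (X v)) => //.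
- move=> A B mA mB.
  pose C t : set (q.-tuple R) := (fun y => tnth y i) @^-1` (if t == u then A else B).
  have mC t : measurable (C t).
    rewrite -[C t]setTI; apply: (measurable_tnth i) => //.
    by case: ifP.
  have := indep [:: u; v] C; rewrite /= inE uv => /(_ isT mC).
  rewrite big_cons big_seq1 => E.
  transitivity (P (\bigcap_(t in [set` [:: u; v]]) (eps t @^-1` C t))).
    congr (P _); apply/seteqP; split => x /=.
      move=> [Ax Bx] t /=; rewrite !inE => /orP[/eqP ->|/eqP ->]; rewrite /C /=.
        by rewrite eqxx.
      by rewrite eq_sym (negbTE uv).
    move=> h; split.
      by have := h u; rewrite /C /= eqxx; apply; rewrite inE eqxx.
    have := h v; rewrite /C /= eq_sym (negbTE uv); apply.
    by rewrite !inE eqxx orbT.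
  rewrite E; congr (P _ * P _)%E; first by rewrite /C eqxx.
  by rewrite /C eq_sym (negbTE uv).
- exact: iM.
- exact: integral_coord.
Qed.

Lemma linear_process_approx (psi : int -> 'M[R[i]]_q) (z : int -> {RV P >-> q.-tuple R})
    (b : 'I_q) (t : nat) (eta : R) :
  linear_process psi eps z -> 0 < eta -> exists N0 : nat, forall N, (N0 <= N)%N ->
    (second_moment P (fun x => ((tnth (z t%:Z x) b)%:C - \sum_(i < q)
      \sum_(0 <= l < (2 * N).+1) psi (l%:Z - N%:Z) b i *
        (tnth (eps (t%:Z - (l%:Z - N%:Z)) x) i)%:C)%R) <= eta%:E)%E.
Proof.
move=> hz eta0.
have /fine_cvgP[fin] := hz t%:Z b.
move=> /cvgrPdist_lt/(_ _ eta0) near_eta.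
have [N0 _ HN] : \forall N \near \oo, _ := filterI fin near_eta.
exists N0 => N NN; have [/= finN] := HN N NN.
rewrite sub0r normrN => ltN.
rewrite (_ : second_moment P _ = ('E_P[(fun x => normc ((cmx (vec (z t%:Z x)) -
    \sum_(0 <= l < (2 * N).+1) psi (l%:Z - N%:Z) *m
      cmx (vec (eps (t%:Z - (l%:Z - N%:Z)) x))) b 0) ^+ 2)%R])%E); last first.
  rewrite /second_moment [@expectation]unlock; apply: eq_integral => x _; congr ((normc _ ^+ 2)%:E).
  rewrite !mxE; congr (_ - _); rewrite summxE exchange_big; apply: eq_bigr => l _.
  by rewrite mxE; apply: eq_bigr => i _; rewrite !mxE.
by rewrite -(fineK finN) lee_fin ltW // (le_lt_trans (ler_norm _)).
Qed.

End Innovations.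

(** * The averaged periodogram as a Gram matrix *)

Section PeriodogramGram.
Context {R : realType}.

Lemma dftE (q p n : nat) (xi : int -> 'cV[R]_q) (w : R) (b : 'I_q) :
  dft p n xi w b 0 =
  ((Num.sqrt (2 * pi * \sum_(1 <= t < n.+1) normc (taper n t ^+ p.-1) ^+ 2))^-1)%:C *
  \sum_(1 <= t < n.+1) (taper n t ^+ p.-1 * cis (w * t%:R)) * (xi t%:Z b 0)%:C.
Proof.
rewrite /dft mxE; congr (_ * _); rewrite summxE; apply: eq_bigr => t _.
by rewrite !mxE.
Qed.

Lemma dft_mul (q1 q2 p n : nat) (A : 'M[R]_(q1, q2)) (xi : int -> 'cV[R]_q2) (w : R) :
  dft p n (fun t => A *m xi t) w = cmx A *m dft p n xi w.
Proof.
rewrite /dft -scalemxAr; congr (_ *: _); rewrite mulmx_sumr; apply: eq_bigr => t _.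
by rewrite cmxM scalemxAr.
Qed.

Definition dft_part (q p n : nat) (xi : int -> 'cV[R]_q) (jb : nat * bool) : 'cV[R]_q :=
  map_mx (if jb.2 then @complex.Re R else @complex.Im R)
    (dft p n xi (fourier_freq n jb.1)).

(** For a complex column [J], the real part of [J J^*] is the sum of the Gram matrices of its real
    and imaginary parts. The averaged periodogram is thus a Gram matrix of [2 m] real vectors. *)
Lemma averaged_periodogram_gram (q p n m : nat) (A : 'M[R]_q) (xi : int -> 'cV[R]_q) :
  averaged_periodogram p n m (fun t => A *m xi t) (fun t => A *m xi t) =
  \sum_(jb <- [seq (j, b) | j <- index_iota 1 m.+1, b <- [:: true; false]])
     (A *m dft_part p n xi jb) *m (A *m dft_part p n xi jb)^T.
Proof.
rewrite big_allpairs; apply: eq_bigr => j _; rewrite big_cons big_seq1.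
have part b (a : 'I_q) : (A *m dft_part p n xi (j, b)) a 0 =
    (if b then @complex.Re R else @complex.Im R)
      (dft p n (fun t => A *m xi t) (fourier_freq n j) a 0).
  rewrite dft_mul /dft_part /=; move: (dft p n xi _) => J.
  case: b; rewrite !mxE ?Re_sum ?Im_sum; apply: eq_bigr => l _.
    by rewrite !mxE Re_mul /= mul0r subr0.
  by rewrite !mxE Im_mul /= mul0r addr0.
apply/matrixP => a b; rewrite /cross_periodogram [LHS]mxE [RHS]mxE ![(_ *m _^T) _ _]mxE.
rewrite !big_ord1 ![_^T _ _]mxE !part /=; move: (dft p n _ _) => J.
rewrite !mxE big_ord1 !mxE; case: (J a 0) => x1 y1; case: (J b 0) => x2 y2 /=.
by rewrite mulrN opprK.
Qed.

Lemma sum_dft_part (q p n m : nat) (xi : int -> 'cV[R]_q) (Q : pred 'I_q) :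
  \sum_(jb <- [seq (j, b) | j <- index_iota 1 m.+1, b <- [:: true; false]])
    \sum_(b | Q b) dft_part p n xi jb b 0 ^+ 2 =
  \sum_(i < m) \sum_(b | Q b) normc (dft p n xi (fourier_freq n i.+1) b 0) ^+ 2.
Proof.
rewrite big_allpairs big_add1 big_mkord; apply: eq_bigr => i _.
rewrite big_cons big_seq1; under [RHS]eq_bigr do rewrite sqr_normcE.
by rewrite [RHS]big_split; congr (_ + _); apply: eq_bigr => b _; rewrite mxE.
Qed.

End PeriodogramGram.

(** Markov's inequality for the measurable majorant [Y]: its level set is the measurable cover of
    the event for [X] that [bigO_p] asks for. *)
Lemma bigO_p_markov (R : realType) (d : measure_display) (T : measurableType d)
    (P : probability T R) (X Y : nat -> T -> R) (c : nat -> R) (K : R) :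
  (forall n x, `|X n x| <= Y n x) -> (forall n, measurable_fun setT (Y n)) ->
  0 <= K -> (\forall n \near \oo, 0 < c n) ->
  (\forall n \near \oo, (\int[P]_x (Y n x)%:E <= (K * c n)%:E)%E) ->
  bigO_p P X c.
Proof.
move=> XY mY K0 cpos EY e e0.
(* Markov's inequality gives probability at most [K / K1]; the added 1 keeps [K1] positive. *)
pose K1 := (K + 1) / e; have K10 : 0 < K1 by rewrite divr_gt0 // ltr_wpDl.
exists K1; near=> n.
have cn : 0 < c n by near: n.
have En : (\int[P]_x (Y n x)%:E <= (K * c n)%:E)%E by near: n.
have Y0 x : 0 <= Y n x by rewrite (le_trans _ (XY n x)).
have K1c : 0 < K1 * c n by rewrite mulr_gt0.
pose E := [set x | ((K1 * c n)%:E <= `|(Y n x)%:E|)%E].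
have mYE : measurable_fun setT (fun x => (Y n x)%:E) by exact/measurable_EFinP.
have mE : measurable E.
  rewrite -[E]setTI; apply: emeasurable_fun_c_infty => //.
  exact: measurableT_comp.
exists E; split => //; last first.
  move=> x /= h; rewrite /E /= lee_fin ger0_norm //; apply: ltW.
  exact: lt_le_trans h (XY n x).
have := le_integral_abse P measurableT mYE K1c; rewrite setTI -/E => h.
have : ((K1 * c n)%:E * P E <= (K * c n)%:E)%E.
  apply: (le_trans h); apply: le_trans En; rewrite le_eqVlt; apply/orP; left; apply/eqP.
  by apply: eq_integral => x _; rewrite gee0_abs // lee_fin.
have PE : P E \is a fin_num by exact: fin_num_measure.
rewrite -(fineK PE) -EFinM !lee_fin mulrAC ler_pM2r // => h2.
have : K1 * fine (P E) <= K1 * e.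
  by rewrite (le_trans h2) // /K1 divfK ?gt_eqF // lerDl.
by rewrite ler_pM2l.
Unshelve. all: by end_near.
Qed.

(** * The order of the eigenvalues *)

Theorem lemma2
  (R : realType) (disp : measure_display) (T : measurableType disp)
  (P : probability T R)
  (* dimensions and blocks *)
  (p q r s : nat) (a : nat -> nat)
  (hp : (1 <= p)%N) (hq : (2 <= q)%N)
  (hs1 : (1 <= s)%N) (hsr : (s <= r)%N) (hrq : (r < q)%N)
  (ha0 : a 0%N = (q - r)%N)
  (ha1 : forall k, (1 <= k <= s)%N -> (1 <= a k)%N)
  (hasum : (\sum_(1 <= k < s.+1) a k)%N = r)
  (* memory parameters *)
  (d : nat -> R)
  (hds : - p%:R + 2^-1 < d s) (hd0 : d 0%N < 2^-1)
  (hd : forall k h, (k < h <= s)%N -> d h < d k)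
  (dd : 'I_q -> 'I_q -> R)
  (hdiag : forall k (i : 'I_q), (k <= s)%N -> in_block a k i -> dd i i = d k)
  (hoff : forall k h (i j : 'I_q), (k <= s)%N -> (h <= s)%N ->
     in_block a k i -> in_block a h j -> i != j -> dd i j <= Num.min (d k) (d h))
  (* transfer function *)
  (tau phi : 'I_q -> 'I_q -> R -> R)
  (htau_pos : forall i j (w : R), - pi <= w <= pi -> 0 < tau i j w)
  (htau_even : forall i j (w : R), - pi <= w <= pi -> tau i j (- w) = tau i j w)
  (hphi_odd : forall i j (w : R), - pi <= w <= pi -> phi i j (- w) = - phi i j w)
  (htau_C1 : forall i j, C1_near0 (tau i j))
  (hphi_C1 : forall i j, C1_near0 (phi i j))
  (Psi : R -> 'M[R[i]]_q)
  (hPsi_conj : forall w : R, - pi <= w <= pi -> w != 0 ->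
     Psi (- w) = map_mx Num.conj (Psi w))
  (hPsi : forall (w : R) i j, - pi <= w <= pi -> w != 0 ->
     Psi w i j = fracdiff (dd i j) w * (tau i j w)%:C * cis (phi i j w))
  (hPsi_L2 : forall i j,
     square_integrable `[- pi, pi] (fun w => Psi w i j))
  (hpsi0 : fourier_coef Psi 0 = 1%:M)
  (* innovations *)
  (Sigma : 'M[R]_q) (hSigma : sym_posdef Sigma)
  (eps : int -> {RV P >-> q.-tuple R})
  (heps_indep : independent_family eps)
  (heps_id : identically_distributed eps)
  (heps_mean : forall t i, ('E_P[fun x => tnth (eps t x) i] = 0%R%:E)%E)
  (heps_cov : forall t i j,
     covariance P (fun x => tnth (eps t x) i) (fun x => tnth (eps t x) j) =
     (2 * pi * Sigma i j)%:E)
  (heps_4 : forall t,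
     ('E_P[fun x => ((\sum_(i < q) tnth (eps t x) i ^+ 2) ^+ 2)%R] < +oo)%E)
  (* the latent process *)
  (z : int -> {RV P >-> q.-tuple R})
  (hz : linear_process (fourier_coef Psi) eps z)
  (* factorisation of its spectral density *)
  (f : R -> 'M[R[i]]_q)
  (hf : forall w : R, f w = Psi w *m cmx Sigma *m (Psi w) ^t*)
  (Upsilon fdag : R -> 'M[R[i]]_q)
  (hUps_diag : forall w : R, is_diag_mx (Upsilon w))
  (hUps : forall (w : R) k (i : 'I_q), - pi <= w <= pi -> w != 0 ->
     (k <= s)%N -> in_block a k i -> Upsilon w i i = fracdiff (d k) w)
  (hf_fact : forall w : R, - pi <= w <= pi -> w != 0 ->
     f w = Upsilon w *m fdag w *m (Upsilon w) ^t*)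
  (hfdag_pos : forall w : R, - pi <= w <= pi -> herm_posdef (fdag w))
  (hfdag_cont : forall i j,
     {for 0, continuous (fun w => complex.Re (fdag w i j))} /\
     {for 0, continuous (fun w => complex.Im (fdag w i j))})
  (hfdag_real : forall i j, complex.Im (fdag 0 i j) = 0)
  (* the observed process *)
  (A : 'M[R]_q) (hA : row_free A^T)
  (hA0 : forall i, exists2 j : 'I_q, in_block a 0 j & A i j != 0)
  (y : int -> T -> 'cV[R]_q)
  (hy : forall t x, y t x = A *m vec (z t x))
  (* ordered eigenvalues of the averaged periodogram *)
  (m : nat) (hm : (q + 3 < m)%N)
  (lam : nat -> T -> 'I_q -> R)
  (hlam : forall n x,
     ordered_eigenvalues
       (averaged_periodogram p n m (fun t => y t x) (fun t => y t x)) (lam n x))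
  (k : nat) (hk : (k <= s)%N) (j : 'I_q) (hj : in_block a k j) :
  bigO_p P (fun n x => lam n x j) (fun n => n%:R `^ (2 * d k)).
Proof.
have mD : measurable (`[- pi, pi]%classic : set R) by exact: measurable_itv.
(* [c] counts the columns of the blocks before block [k]. Coordinates start from 0, so [j] in block
   [k] gives [c <= j]. *)
pose c := (\sum_(l < k) a l)%N.
have /andP[cj _] := hj.
have hc : (c <= q)%N by rewrite (leq_trans cj) // ltnW.
have qE : (\sum_(l < s.+1) a l)%N = q.
  by rewrite -(big_mkord predT a) big_ltn // hasum ha0 subnK // ltnW.
have d_mono h : (k <= h <= s)%N -> d h <= d k.
  move=> /andP[]; rewrite leq_eqVlt => /orP[/eqP -> //|kh] hs.
  by rewrite ltW // hd // kh.
have d_lt k' : (k' <= s)%N -> d k' < 2^-1.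
  case: k' => // k' ks; apply: lt_trans hd0; exact: hd.
have d_gt : - p%:R + 2^-1 < d k.
  by apply: lt_le_trans hds _; move: hk; rewrite leq_eqVlt => /orP[/eqP -> //|ks];
    rewrite ltW // hd // ks /=.
(* A coordinate [b >= c] lies in a block [h >= k]. On the diagonal its exponent is [d h], off it at
   most [d h], and [d] decreases, so a whole row of the transfer function obeys the bound with
   [d k]. *)
have dd_le (b i : 'I_q) : (c <= b)%N -> dd b i <= d k.
  move=> cb; have [|h [kh hs hb]] := @in_block_from a k s b cb.
    by rewrite qE.
  have dh : d h <= d k by apply: d_mono; rewrite kh.
  have [<-|bi] := eqVneq b i; first by rewrite (hdiag _ _ hs hb).
  have i0 : (\sum_(l < 0) a l <= i)%N by rewrite big_ord0.
  have iq : (i < \sum_(l < s.+1) a l)%N by rewrite qE.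
  have [h' [_ hs' hi]] := in_block_from i0 iq.
  apply: le_trans dh; apply: (le_trans (hoff _ _ _ _ hs hs' hb hi bi)).
  by rewrite ge_min lexx.
pose e (i : 'I_q) (u : int) (x : T) : R := tnth (eps u x) i.
pose sg (i : 'I_q) : R := 2 * pi * Sigma i i.
pose s' : R := \sum_i `|sg i|.
have s'0 : 0 <= s' by exact: sumr_ge0.
have sgs i : sg i <= s'.
  by rewrite /s' (bigD1 i) //= (le_trans (ler_norm _)) // lerDl sumr_ge0.
have me i u : measurable_fun setT (e i u) by exact: measurable_coord.
have ie i u v : P.-integrable setT (fun x => (e i u x * e i v x)%:E).
  exact: integrable_coord_mul.
have e2 i u : (\int[P]_x (e i u x * e i u x)%:E)%E = (sg i)%:E.
  exact: integral_coord_sqr.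
have eo i u v : u != v -> (\int[P]_x (e i u x * e i v x)%:E)%E = 0%E.
  move=> uv; apply: integral_coord_orth => //.
  by move=> u' v'; exact: ie.
(* The condition [c <= b] stands under the existential, with default constant 0 when it fails, so
   that [choice] gives one function on all coordinates. *)
have mom (b : 'I_q) : exists K : R, 0 <= K /\ ((c <= b)%N ->
    forall n i, (1 < n)%N -> (i <= m)%N ->
    (second_moment P (fun x => dft p n (fun t => vec (z t x)) (fourier_freq n i) b 0)%R
      <= (K * n%:R `^ (2 * d k))%:E)%E).
  have [cb|cb] := boolP (c <= b)%N; last by exists 0.
  have gi (i : 'I_q) := hPsi_L2 b i.
  have zm (t : nat) : measurable_fun setT (fun x => tnth (z t%:Z x) b).
    exact: measurable_coord.
  have hz' (t : nat) (eta : R) : 0 < eta -> exists N0 : nat, forall N, (N0 <= N)%N ->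
    (second_moment P (fun x => ((tnth (z t%:Z x) b)%:C - \sum_(i < q)
      \sum_(0 <= l < (2 * N).+1) fourier (fun w => Psi w b i) (l%:Z - N%:Z) *
        (e i (t%:Z - (l%:Z - N%:Z)) x)%:C)%R) <= eta%:E)%E.
    move=> eta0; have [N0 HN] := linear_process_approx b t hz eta0.
    exists N0 => N NN; have := HN N NN; congr (second_moment P _ <= _)%E.
    apply/funext => x; congr (_ - _); apply: eq_bigr => i _; apply: eq_bigr => l _.
    by rewrite mxE.
  have g0 (i : 'I_q) : exists delta A : R, [/\ 0 < delta, 0 <= A &
      forall w, w != 0 -> `|w| <= pi -> `|w| < delta ->
      normc (Psi w b i) ^+ 2 <= A * `|w| `^ (- (2 * d k))].
    apply: (near0_fracdiff_le (dd_le b i cb) (htau_C1 b i)) => w wpi w0.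
    exact: hPsi.
  have [K K0 HK] := dft_second_moment me ie e2 eo sgs s'0 gi zm hz' hp (d_lt k hk) d_gt g0 m.
  exists K; split => // _ n i n1 im; have := HK n i n1 im.
  congr (second_moment P _ <= _)%E; apply/funext => x; rewrite dftE.
  by congr (_ * _); apply: eq_bigr => t _; rewrite mxE.
have [K HK] := choice mom.
pose W n (ib : 'I_m * 'I_q) x :=
  dft p n (fun t => vec (z t x)) (fourier_freq n ib.1.+1) ib.2 0.
have mW n ib : cmeasurable setT (W n ib).
  rewrite (_ : W n ib = fun x =>
     ((Num.sqrt (2 * pi * \sum_(1 <= t < n.+1) normc (taper n t ^+ p.-1) ^+ 2))^-1)%:C *
     \sum_(1 <= t < n.+1) (taper n t ^+ p.-1 * cis (fourier_freq n ib.1.+1 * t%:R)) *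
       (tnth (z t%:Z x) ib.2)%:C); last first.
    apply/funext => x; rewrite /W dftE; congr (_ * _); apply: eq_bigr => t _.
    by rewrite mxE.
  apply: cmeasurableM; first exact: cmeasurable_cst.
  apply: cmeasurable_sum => t; apply: cmeasurableM; first exact: cmeasurable_cst.
  by apply: cmeasurable_real; exact: measurable_coord.
pose F := q%:R ^+ 2 * (\sum_a0 \sum_b A a0 b ^+ 2).
have F0 : 0 <= F.
  rewrite mulr_ge0 ?sqr_ge0 // sumr_ge0 // => i _; rewrite sumr_ge0 // => b _.
  exact: sqr_ge0.
pose beta n x := F * \sum_(ib : 'I_m * 'I_q | (c <= ib.2)%N) normc (W n ib x) ^+ 2.
have lam_le n x : `|lam n x j| <= beta n x.
  have Hlam := hlam n x.
  have yE : (fun t => y t x) = (fun t => A *m vec (z t x)) by apply/funext => t; exact: hy.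
  rewrite yE averaged_periodogram_gram in Hlam.
  rewrite ger0_norm; last first.
    by apply: (ordered_eigenvalues_ge0 Hlam) => v; exact: gram_psd.
  have betaE : beta n x = F * \sum_(i < m) \sum_(b < q | (c <= b)%N)
      normc (dft p n (fun t => vec (z t x)) (fourier_freq n i.+1) b 0) ^+ 2.
    by rewrite /beta pair_big_dep.
  (* The constraints are the first [c] columns of [A], those multiplying the more strongly dependent
     blocks. *)
  apply: (ordered_eigenvalues_le
    (B := \matrix_(b < q, l < c) A b (widen_ord hc l)) (gram_sym _ _) Hlam _ cj) => v vA.
  apply: (le_trans (gram_kernel_le _ _ vA)).
  rewrite (sum_dft_part p n m (fun t => vec (z t x)) (fun b : 'I_q => (c <= b)%N)).
  by rewrite -betaE.
pose KK := F * \sum_(ib : 'I_m * 'I_q | (c <= ib.2)%N) K ib.2.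
have KK0 : 0 <= KK by rewrite mulr_ge0 // sumr_ge0 // => ib _; exact: (HK ib.2).1.
apply: (@bigO_p_markov _ _ _ P _ beta _ KK) => //.
- move=> n; apply: measurable_funM => //; under eq_fun do rewrite -big_filter.
  by apply: measurable_sum => ib; exact: cmeasurable_sqr_normc.
- by exists 1%N => // n /= n1; rewrite powR_gt0 // ltr0n.
- exists 2%N => // n /= n2.
  apply: (@le_trans _ _ (\sum_(ib <- [seq ib : 'I_m * 'I_q <- index_enum _ | (c <= ib.2)%N])
      F%:E * second_moment P (W n ib))%E).
    apply: (@integral_le_sum _ _ _ P _ _ (fun=> F)) => //.
    + by move=> ib x; exact: sqr_ge0.
    + by move=> ib; exact: cmeasurable_sqr_normc.
    + apply: measurable_funM => //; under eq_fun do rewrite -big_filter.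
      by apply: measurable_sum => ib; exact: cmeasurable_sqr_normc.
    + by move=> x; rewrite mulr_ge0 // sumr_ge0 // => ib _; exact: sqr_ge0.
    + by move=> x; rewrite -mulr_sumr big_filter.
  rewrite big_filter /KK -mulrA mulr_suml mulr_sumr -sumEFin; apply: lee_sum => ib cib.
  rewrite [leRHS]EFinM; apply: lee_wpmul2l; first by rewrite lee_fin.
  by apply: (HK ib.2).2 => //; exact: ltn_ord.
Qed.
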